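(* There exists a function $f:[1,\infty)\to\mathbb{R}$ with $f(x)=0$ for $x\le20$ and \[ f(x)=x\log x-x\log\log\log x+O(x)\qquad(x\ge20), \] such that the following holds. Let $1\le k\le n$ be integers and let $I_1,\ldots,I_m$ be disjoint subsets of $[k]$. Then for any set $\mathcal{J}\subseteq\mathbb{N}_0^m$, \[ \mathbb{P}\Big((C_{I_1}(\sigma),\ldots,C_{I_m}(\sigma))\in\mathcal{J}\Big)=\mathbb{P}\Big((Y_1,\ldots,Y_m)\in\mathcal{J}\Big)+O\big(e^{-f(n/k)}\big), \] where for each $i$, $Y_i$ is Poisson with parameter $H(I_i)$, and $Y_1,\ldots,Y_m$ are independent.
   Context: $[k]=\{1,\ldots,k\}$ and $\mathbb{N}_0=\{0,1,2,\ldots\}$. $\sigma$ is a uniformly random permutation in the symmetric group $\mathcal{S}_n$ on $\{1,\ldots,n\}$. For a set $I$ of positive integers, $C_I(\sigma)$ is the number of cycles of $\sigma$ whose lengths lie in $I$ (fixed points count as cycles of length 1), and $H(I)=\sum_{j\in I}1/j$; a Poisson variable with parameter $0$ is identically $0$. All constants implied by $O$ are absolute (in particular independent of $n,k,m$, the sets $I_i$ and $\mathcal{J}$). *)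

(* Defs.v *)
From HB Require Import structures.
From mathcomp Require Import all_boot all_order all_algebra all_fingroup finmap.
From mathcomp Require Import all_classical all_reals all_analysis.

Set Implicit Arguments.
Unset Strict Implicit.
Unset Printing Implicit Defensive.

Import Order.TTheory GRing.Theory Num.Theory.

Local Open Scope classical_set_scope.
Local Open Scope ring_scope.

(* 'S_n permutes {0, ..., n-1} rather than {1, ..., n}; only the lengths of the
   cycles matter. The orbits in [porbits s] include the fixed points. *)
Definition cycle_count (n : nat) (I : {fset nat}) (s : 'S_n) : nat :=
  #|[set c in porbits s | #|c| \in I]|.

Definition harmonic_sum (R : realType) (I : {fset nat}) : R :=
  \sum_(j <- I) (j%:R)^-1.

Definition uniform_perm_prob (R : realType) (n : nat) (E : set 'S_n) : R :=
  #|[set s : 'S_n | `[< E s >]]%SET|%:R / #|[set: 'S_n]%SET|%:R.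

Definition mutually_independent (R : realType) (d d' : measure_display)
    (T : measurableType d) (T' : measurableType d') (P : probability T R)
    (A : finType) (X : A -> {RV P >-> T'}) : Prop :=
  forall (S : {set A}) (B : A -> set T'), (forall a, measurable (B a)) ->
    P [set w | forall a, a \in S -> B a (X a w)] =
    (\prod_(a in S) P (X a @^-1` B a))%E.

(* The last argument of the library's [poisson_prob] is a dummy, and
   [poisson_prob 0 _] is the Dirac mass at 0. *)
Definition has_poisson_law (R : realType) (d : measure_display)
    (T : measurableType d) (P : probability T R) (X : {RV P >-> nat})
    (rate : R) : Prop :=
  forall B : set nat, distribution P X B = poisson_prob rate 0%N B.

(* Main.v *)
Require Import Defs.
From HB Require Import structures.
From mathcomp Require Import all_boot all_order all_algebra all_fingroup finmap.
From mathcomp Require Import all_classical all_reals all_analysis.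
From mathcomp Require Import ring lra zify.

(** The argument compares two expansions over the same family of terms.

    Write h(z) for the sum of z^j / j over 1 <= j <= k, so that h(1) = H_k is
    the k-th harmonic number.  Each cycle of length j contributes a vector
    [e j] to a cycle statistic, with [e j = 0] for j > k.  For a function phi
    of the statistic let B_r(phi) be the z^r-coefficient of the exponential of
    the operator sum of (z^j / j) S_j over j <= k, applied to phi and evaluated
    at 0, where (S_j phi) v = phi (e j + v) ([exp_coef]).  Removing the cycle
    through a marked point gives a recurrence for the mean of phi over a
    uniform permutation of n points ([sum_cycle_stat]), whose solution is
      E_n phi = sum over r <= n of B_r(phi) p_(n-r)          ([perm_meanS]),
    p_m being the z^m-coefficient of exp(-h(z)) / (1 - z), that is the
    probability that a permutation of m points has no cycle of length <= k.
    On the other side the Poisson mean of phi is e^(-H_k) times the sum of all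
    the B_r(phi) ([poisson_pointE], [sum_marks_mass_point]).  Hence the two
    means differ only through the differences e^(-H_k) - p_(n-r).

    The p_m converge to e^(-H_k) very fast: their increments d_m satisfy
    m d_m = - (d_(m-1) + ... + d_(m-k)), so that their size drops by a factor q
    when m passes q k, and therefore, with q of order m/k,
      e^(-H_k) - p_m <= 2 / ((k + 1) q!)                      ([no_short_osc]).
    For any u >= 1 and v = u^(1/k), 1/q! <= e^u u^(-q) turns this into a
    multiple of v^(-m) ([no_short_lower]), and the sum of B_r(1) v^r is
    e^(h(v)) <= e^(H_k + u - 1); here e^(H_k) = O(k) compensates the factor
    1/(k + 1).  With u = x = n/k the total error is at most
    2 exp(3 x - x log x) ([perm_mean_lower_exp]), and log log log x >= -1 for
    x >= 20 allows f x = x log x - x log log log x - 4 x.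

    Only the inequality P(Y in J) <= P(C in J) + error has to be proved:
    applied to the complement of J it yields the converse.  Since it is
    one-sided, J may be replaced by its finite sections and the Poisson
    expansion by its partial sums. *)

Set Implicit Arguments.
Unset Strict Implicit.
Unset Printing Implicit Defensive.

Import Order.TTheory GRing.Theory Num.Theory.
Import numFieldNormedType.Exports.

Local Open Scope classical_set_scope.
Local Open Scope ring_scope.

(** * Removing the cycle through a marked point *)

(** The function of the statistic seen once a cycle of length [j.+1] has been
    set aside. *)
Definition shift_cycle (V : nmodType) (R : Type) (e : nat -> V) (j : nat)
  (phi : V -> R) : V -> R := fun v => phi (e j.+1 + v).

(** Cycles are restricted to a subset of the ground type, so that permutations of
    all smaller sizes live in one type and an induction on the size needs no
    transport between types. *)
Definition cycle_stat (V : nmodType) (e : nat -> V) (T : finType)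
    (A : {set T}) (s : {perm T}) : V :=
  \sum_(c in porbits s | c \subset A) e #|c|.

Lemma porbit_sub (T : finType) (s : {perm T}) (A : {set T}) x :
  (forall z, z \in A -> s z \in A) -> x \in A -> porbit s x \subset A.
Proof.
move=> sA xA; apply/fintype.subsetP => _ /porbitP[i ->].
elim: i => [|i IHi]; first by rewrite expg0 perm1.
by rewrite expgSr permM sA.
Qed.

Lemma card_porbit_eq1 (T : finType) (s : {perm T}) x :
  (#|porbit s x| == 1%N) = (s x == x).
Proof.
apply/idP/eqP => [/cards1P[y xy]|sx].
  have := mem_porbit s 1 x; have := porbit_id s x.
  by rewrite xy expg1 !inE => /eqP -> /eqP ->.
apply/cards1P; exists x; apply/eqP.
rewrite finset.eqEsubset finset.sub1set porbit_id andbT.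
by apply: porbit_sub; [move=> z; rewrite !inE => /eqP ->; rewrite sx | rewrite inE].
Qed.

(** Composing with this transposition cuts [s x] out of the cycle of [x], which
    goes on directly from [x] to [s (s x)]. *)
Lemma porbit_tpermM (T : finType) (s : {perm T}) x : s x != x ->
  porbit (tperm x (s x) * s)%g x = porbit s x :\ s x.
Proof.
move=> sx; set t := (_ * s)%g.
have tE z : t z = s (tperm x (s x) z) by rewrite permM.
have sxO : s x \in porbit s x by have := mem_porbit s 1 x; rewrite expg1.
have stO z : z \in porbit s x -> s z \in porbit s x.
  by case/porbitP => i ->; rewrite -permM -expgSr mem_porbit.
have ttO z : z \in porbit t x -> t z \in porbit t x.
  by case/porbitP => i ->; rewrite -permM -expgSr mem_porbit.
have tsx : t (s x) = s x by rewrite tE tpermR.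
apply/eqP; rewrite finset.eqEsubset; apply/andP; split.
  apply: porbit_sub => [z|]; last by rewrite !inE eq_sym sx porbit_id.
  rewrite !inE => /andP[zsx zO]; apply/andP; split.
    by apply: contra zsx => /eqP tz; apply/eqP/(@perm_inj _ t); rewrite tz tsx.
  rewrite tE; apply: stO; case: tpermP => // _.
  exact: porbit_id.
rewrite finset.subDset; apply: porbit_sub => [z|]; last by rewrite !inE porbit_id orbT.
rewrite !inE => /orP[/eqP ->|zO].
  by have := ttO _ (porbit_id t x); rewrite tE tpermL => ->; rewrite orbT.
have [->|zx] := eqVneq z x; first by rewrite eqxx.
have [->|zsx] := eqVneq z (s x).
  by have := ttO _ (porbit_id t x); rewrite tE tpermL => ->; rewrite orbT.
by have := ttO _ zO; rewrite tE tpermD 1?eq_sym// => ->; rewrite orbT.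
Qed.

Lemma porbit_eq_off (T : finType) (s t : {perm T}) (A : {set T}) z :
    (forall w, w \in A -> s w \in A) -> {in A, s =1 t} -> z \in A ->
  porbit s z = porbit t z.
Proof.
move=> sA st zA.
suff H i : (s ^+ i)%g z = (t ^+ i)%g z /\ (s ^+ i)%g z \in A.
  apply/setP => w; apply/porbitP/porbitP => -[i ->]; exists i.
    by case: (H i).
  by case: (H i).
elim: i => [|i [IH1 IH2]]; first by rewrite !expg0 !perm1.
by rewrite !expgSr !permM -IH1 sA// st.
Qed.

(** The surgery does not affect the other cycles. *)
Lemma cycle_stat_tpermM (V : nmodType) (e : nat -> V) (T : finType)
    (A : {set T}) (s : {perm T}) x : s x != x ->
  cycle_stat e (A :\: porbit s x) (tperm x (s x) * s)%g =
  cycle_stat e (A :\: porbit s x) s.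
Proof.
move=> sx; set t := (_ * s)%g; set B := A :\: _.
have sC z : z \in ~: porbit s x -> s z \in ~: porbit s x.
  rewrite !inE; apply: contra; rewrite porbit_sym => sz.
  by rewrite porbit_sym -(porbit_perm s 1 z) expg1.
have st : {in ~: porbit s x, s =1 t}.
  move=> z; rewrite inE => zO; rewrite permM tpermD//.
    by apply: contraNneq zO => <-; rewrite porbit_id.
  by apply: contraNneq zO => <-; have := mem_porbit s 1 x; rewrite expg1.
have orbE z : z \in ~: porbit s x -> porbit s z = porbit t z.
  exact: porbit_eq_off.
have Bsub (c : {set T}) : c \subset B -> forall z, z \in c -> z \in ~: porbit s x.
  by move=> /fintype.subsetP cB z zc; have := cB _ zc; rewrite !inE => /andP[].
apply: eq_bigl => c; apply/andP/andP => -[/imsetP[z _ cE] cB]; split=> //;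
  apply/imsetP; exists z => //; have zC : z \in ~: porbit s x.
- by apply: Bsub cB _ _; rewrite cE porbit_id.
- by rewrite orbE.
- by apply: Bsub cB _ _; rewrite cE porbit_id.
- by rewrite -orbE.
Qed.

Lemma cycle_statD1 (V : nmodType) (e : nat -> V) (T : finType)
    (A : {set T}) (s : {perm T}) x : perm_on A s -> x \in A ->
  cycle_stat e A s = e #|porbit s x| + cycle_stat e (A :\: porbit s x) s.
Proof.
move=> sA xA; have sOA : porbit s x \subset A.
  by apply: porbit_sub xA => z zA; rewrite perm_closed.
rewrite /cycle_stat (bigD1 (porbit s x)) ?imset_f//=; congr (_ + _).
apply: eq_bigl => c; rewrite -andbA; case: imsetP => //= -[z _ ->].
rewrite finset.subsetD; case: (_ \subset A) => //=.
rewrite eq_porbit_mem; apply/idP/pred0P => [zx w /=|/(_ z)/=].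
  apply: contraNF zx => /andP[]; rewrite -!eq_porbit_mem.
  by move=> /eqP <- /eqP ->.
by rewrite porbit_id/= => ->.
Qed.

Lemma sum_perm_on_fix (R : nmodType) (T : finType) (A : {set T}) x
    (F : {perm T} -> R) :
  \sum_(s | perm_on A s && (s x == x)) F s =
  \sum_(s | perm_on (A :\ x) s) F s.
Proof.
apply: eq_bigl => s; apply/andP/idP => [[/fintype.subsetP sA /eqP sx]|/fintype.subsetP sA].
  apply/fintype.subsetP => z zs; rewrite inE (sA _ zs) andbT inE.
  by apply: contraTneq zs => ->; rewrite inE sx eqxx.
split; first by apply/fintype.subsetP => z /sA; rewrite inE => /andP[].
by apply: contraT => sx; have := sA x; rewrite !inE eqxx => /(_ sx).
Qed.

(** Leaving the cycle of the marked point out of the statistic makes these sums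
    insensitive to the shortening of that cycle. *)
Definition marked_sum (R : nmodType) (V : nmodType) (e : nat -> V) (T : finType)
    (A : {set T}) (x : T) (j : nat) (phi : V -> R) : R :=
  \sum_(s : {perm T} | perm_on A s && (#|porbit s x| == j))
     phi (cycle_stat e (A :\: porbit s x) s).

Lemma marked_sum1 (R : nmodType) (V : nmodType) (e : nat -> V) (T : finType)
    (A : {set T}) (x : T) (phi : V -> R) :
  marked_sum e A x 1 phi =
  \sum_(s | perm_on (A :\ x) s) phi (cycle_stat e (A :\ x) s).
Proof.
rewrite -sum_perm_on_fix /marked_sum.
under eq_bigl do rewrite card_porbit_eq1.
apply: eq_bigr => s /andP[_ sx]; congr (phi (cycle_stat e (_ :\: _) s)).
by move: sx; rewrite -card_porbit_eq1 => /cards1P[y xy]; have := porbit_id s x;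
  rewrite xy inE => /eqP ->.
Qed.

(** Erasing the successor [y] of [x] is a bijection onto the permutations of
    [A :\ y] in which the cycle of [x] is one step shorter. *)
Lemma marked_sumS (R : nmodType) (V : nmodType) (e : nat -> V) (T : finType)
    (A : {set T}) (x : T) (j : nat) (phi : V -> R) : x \in A ->
  marked_sum e A x j.+2 phi =
  \sum_(y in A :\ x) marked_sum e (A :\ y) x j.+1 phi.
Proof.
move=> xA; rewrite /marked_sum.
rewrite (partition_big (fun s : {perm T} => s x) (mem (A :\ x)))/=; last first.
  move=> s /andP[sA /eqP sj]; rewrite !inE perm_closed// xA andbT.
  by rewrite -card_porbit_eq1 sj.
apply: eq_bigr => y; rewrite !inE => /andP[yx yA].
rewrite (reindex_onto (fun t => tperm x y * t)%g (fun t => tperm x y * t)%g)/=;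
  last by move=> s _; rewrite mulgA tperm2 mul1g.
apply: eq_big => [t|t /andP[/andP[/andP[tA _] /eqP tx] _]]; last first.
  set s := (tperm x y * t)%g in tA tx *.
  have sx : s x != x by rewrite tx.
  have tE : t = (tperm x (s x) * s)%g by rewrite tx mulgA tperm2 mul1g.
  have tO : porbit t x = porbit s x :\ y by rewrite {1}tE porbit_tpermM// tx.
  have yO : y \in porbit s x by rewrite -tx; have := mem_porbit s 1 x; rewrite expg1.
  rewrite tO {1}tE -cycle_stat_tpermM// -tE; congr (phi (cycle_stat e _ t)).
  apply/setP => z; rewrite !inE; case: eqVneq => [->|]//=; rewrite ?yO//.
set s := (tperm x y * t)%g.
have tE : t = (tperm x y * s)%g by rewrite mulgA tperm2 mul1g.
rewrite -tE eqxx andbT; have sxE : s x = t y by rewrite permM tpermL.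
have tyE : t y = s x by [].
apply/andP/andP => [[/andP[sA /eqP sj] /eqP sx]|[tA /eqP tj]]; last first.
  have ty : t y = y.
    apply/eqP/contraT => ty.
    by have := fintype.subsetP tA y; rewrite !inE eqxx => /(_ ty).
  have sx : s x = y by rewrite sxE.
  have sA : perm_on A s.
    have tA' : perm_on A t by apply: fintype.subset_trans tA _; apply: finset.subsetDl.
    apply: perm_onM tA'; apply: fintype.subset_trans (tperm_on x y) _.
    by apply/fintype.subsetP => z; rewrite !inE => /orP[] /eqP ->.
  split; rewrite ?sx// sA/=.
  have := porbit_tpermM (s := s) (x := x); rewrite sx -tE => /(_ yx) tO.
  have yO : y \in porbit s x by rewrite -sx; have := mem_porbit s 1 x; rewrite expg1.
  by rewrite (cardsD1 y) yO -tO tj.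
have tA : perm_on A t.
  rewrite tE; apply: perm_onM sA; apply: fintype.subset_trans (tperm_on x y) _.
  by apply/fintype.subsetP => z; rewrite !inE => /orP[] /eqP ->.
split.
  apply/fintype.subsetP => z zt; rewrite inE (fintype.subsetP tA _ zt) andbT inE.
  by apply: contraTneq zt => ->; rewrite inE tyE sx eqxx.
have := porbit_tpermM (s := s) (x := x); rewrite sx -tE => /(_ yx) ->.
have yO : y \in porbit s x by rewrite -sx; have := mem_porbit s 1 x; rewrite expg1.
by move: sj; rewrite (cardsD1 y) yO add1n => -[->].
Qed.

Lemma sum_cycle_stat_marked (R : nmodType) (V : nmodType) (e : nat -> V)
    (T : finType) (A : {set T}) (x : T) (phi : V -> R) : x \in A ->
  \sum_(s | perm_on A s) phi (cycle_stat e A s) =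
  \sum_(j < #|A|) marked_sum e A x j.+1 (shift_cycle e j phi).
Proof.
move=> xA; have oA (s : {perm T}) : perm_on A s -> (#|porbit s x| <= #|A|)%N.
  by move=> sA; apply/subset_leq_card/porbit_sub => // z zA; rewrite perm_closed.
(* The length of the cycle of [x], minus one, as an index below [#|A|]. *)
pose g (s : {perm T}) : 'I_#|A| := insubd (Ordinal (n:=#|A|) (m:=0)
  (ltac:(by rewrite card_gt0; apply/finset.set0Pn; exists x))) #|porbit s x|.-1.
have gE s : perm_on A s -> (g s).+1 = #|porbit s x|.
  move=> sA; have := card_porbit_neq0 s x; have := oA s sA.
  rewrite /g val_insubd; case: #|porbit s x| => //= o -> //.
rewrite (partition_big g predT)//=; apply: eq_bigr => j _.
apply: eq_big => s => [|/andP[sA /eqP <-]]; last first.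
  by rewrite /shift_cycle (cycle_statD1 e sA xA) gE.
by case sA : (perm_on A s) => //=; rewrite -val_eqE/= -eqSS gE.
Qed.

(** Erasing successors one at a time leaves [n (n - 1) ... (n - j + 1)] choices and
    a permutation of the [n - j] points outside the cycle of [x]. *)
Lemma marked_sumE (R : pzSemiRingType) (V : nmodType) (e : nat -> V)
    (a : nat -> (V -> R) -> R) (T : finType) (n j : nat) :
    (forall (A : {set T}) phi, (#|A| <= n)%N ->
      \sum_(s | perm_on A s) phi (cycle_stat e A s) = (#|A|)`!%:R * a #|A| phi) ->
  (j <= n)%N -> forall (A : {set T}) x phi, #|A| = n.+1 -> x \in A ->
  marked_sum e A x j.+1 phi = n`!%:R * a (n - j)%N phi.
Proof.
elim: j n => [|j IHj] n IHn jn A x phi cA xA.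
  have cAx : #|A :\ x| = n by move: cA; rewrite (cardsD1 x) xA => -[].
  by rewrite marked_sum1 IHn cAx// subn0.
case: n IHn jn cA => // n IHn jn cA.
rewrite marked_sumS//.
rewrite (eq_bigr (fun => n`!%:R * a (n - j)%N phi)) => [|y]; last first.
  rewrite !inE => /andP[yx yA]; apply: IHj => //.
  - by move=> B psi Bn; apply: IHn; apply: leqW.
  - by move: cA; rewrite (cardsD1 y) yA => -[].
  - by rewrite !inE eq_sym yx.
rewrite sumr_const (_ : #|_| = n.+1); last by move: cA; rewrite (cardsD1 x) xA => -[].
by rewrite factS natrM -mulrA [RHS]mulr_natl subSS.
Qed.

(** Conditioning on the length of the cycle of one point gives the recurrence
    assumed for [a], which has only one solution: the mean of [phi]. *)
Lemma sum_cycle_stat (R : pzSemiRingType) (V : nmodType) (e : nat -> V)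
    (a : nat -> (V -> R) -> R)
    (a0 : forall phi, a 0%N phi = phi 0)
    (aS : forall n phi, n.+1%:R * a n.+1 phi =
       \sum_(j < n.+1) a (n - j)%N (shift_cycle e j phi))
    (T : finType) (A : {set T}) (phi : V -> R) :
  \sum_(s | perm_on A s) phi (cycle_stat e A s) = (#|A|)`!%:R * a #|A| phi.
Proof.
suff H n : forall A : {set T}, #|A| = n -> forall phi,
    \sum_(s | perm_on A s) phi (cycle_stat e A s) = n`!%:R * a n phi.
  exact: H.
elim/ltn_ind: n => -[|n] IHn {phi}A cA phi.
  move/cards0_eq: cA => ->; rewrite fact0 mul1r a0.
  rewrite (big_pred1 1%g) => [|s]; last first.
    apply/idP/eqP => [s0|->]; last exact: perm_on1.
    by apply: perm_on_id s0 _; rewrite cards0.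
  congr (phi _); rewrite /cycle_stat big_pred0// => c; apply/negbTE/negP.
  rewrite finset.subset0 => /andP[/imsetP[x _ ->] /eqP xO].
  by have := porbit_id 1 x; rewrite xO inE.
have [x xA] : exists x, x \in A by apply/finset.set0Pn; rewrite -card_gt0 cA.
rewrite (sum_cycle_stat_marked _ _ xA) cA factS mulnC natrM -mulrA aS.
rewrite mulr_sumr; apply: eq_bigr => -[j /= jn] _.
apply: marked_sumE => // B psi Bn.
exact: IHn.
Qed.

(** * Generating functions of the short cycles *)

Lemma shift_cycleC (V : nmodType) (R : Type) (e : nat -> V) i j (phi : V -> R) :
  shift_cycle e i (shift_cycle e j phi) = shift_cycle e j (shift_cycle e i phi).
Proof. by apply/funext => v; rewrite /shift_cycle addrCA. Qed.

(** The [s]-th power of the operator sum of (z^j / j) S_j over j <= k, applied to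
    [phi] at 0: a generating polynomial, by total length, of the [s]-tuples of
    cycle lengths at most [k]. *)
Fixpoint marks_poly (R : numFieldType) (V : nmodType) (e : nat -> V) (k s : nat)
    (phi : V -> R) : {poly R} :=
  if s is s'.+1 then
    \sum_(j < k) j.+1%:R^-1 *: ('X^(j.+1) * marks_poly e k s' (shift_cycle e j phi))
  else (phi 0)%:P.

Lemma marks_polyS (R : numFieldType) (V : nmodType) (e : nat -> V) k s
    (phi : V -> R) : marks_poly e k s.+1 phi =
  \sum_(j < k) j.+1%:R^-1 *: ('X^(j.+1) * marks_poly e k s (shift_cycle e j phi)).
Proof. by []. Qed.

(** The rule (h^s)' = s h' h^(s-1); the factors commute since shifts do. *)
Lemma deriv_marks_poly (R : numFieldType) (V : nmodType) (e : nat -> V) k s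
    (phi : V -> R) :
  (marks_poly e k s.+1 phi)^`() =
  s.+1%:R *: \sum_(j < k) 'X^j * marks_poly e k s (shift_cycle e j phi).
Proof.
elim: s phi => [|s IHs] phi.
  rewrite scale1r /= raddf_sum; apply: eq_bigr => j _ /=.
  rewrite derivZ derivM derivC mulr0 addr0 derivXn /= mulrnAl -[('X^j * _) *+ _]scaler_nat.
  by rewrite scalerA mulVf ?pnatr_eq0// scale1r.
rewrite marks_polyS raddf_sum.
under eq_bigr do rewrite /= derivZ derivM IHs derivXn /= scalerDr.
rewrite big_split /= -[s.+2]add1n natrD scalerDl scale1r; congr (_ + _).
  apply: eq_bigr => j _; rewrite mulrnAl -[('X^j * _) *+ _]scaler_nat.
  by rewrite scalerA mulVf ?pnatr_eq0// scale1r.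
rewrite scaler_sumr.
under eq_bigr do rewrite -scalerAr scalerA mulrC -scalerA mulr_sumr scaler_sumr
  scaler_sumr.
rewrite exchange_big /=; apply: eq_bigr => i _.
rewrite mulr_sumr scaler_sumr; apply: eq_bigr => j _; congr (_ *: _).
by rewrite shift_cycleC -scalerAr !mulrA; congr (_ *: (_ * _)); rewrite mulrC.
Qed.

Lemma coef_marks_poly_lt (R : numFieldType) (V : nmodType) (e : nat -> V) k s r
    (phi : V -> R) : (r < s)%N -> (marks_poly e k s phi)`_r = 0.
Proof.
elim: s r phi => // s IHs r phi rs /=; rewrite coef_sum big1// => j _.
rewrite coefZ coefXnM; case: ltnP => jr; first by rewrite mulr0.
by rewrite IHs ?mulr0// ltn_subLR// addSn ltnS (leq_trans _ (leq_addl _ _)).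
Qed.

(** The coefficient of z^r in exp (c h(z)), where h(z) stands for the operator sum
    of (z^j / j) S_j, applied to [phi] at 0.  The sum stops at [s = r] because h
    has no constant term.  The values c = 1 and c = -1 serve respectively for the
    short cycles and for their absence. *)
Definition exp_coef (R : numFieldType) (V : nmodType) (e : nat -> V) k (c : R) r
    (phi : V -> R) : R :=
  \sum_(s < r.+1) c ^+ s / s`!%:R * (marks_poly e k s phi)`_r.

Lemma exp_coef_widen (R : numFieldType) (V : nmodType) (e : nat -> V) k (c : R) r
    (phi : V -> R) N : (r < N)%N ->
  exp_coef e k c r phi = \sum_(s < N) c ^+ s / s`!%:R * (marks_poly e k s phi)`_r.
Proof.
move=> rN; rewrite /exp_coef (big_ord_widen N (fun s => c ^+ s / s`!%:R * (marks_poly e k s phi)`_r) rN).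
rewrite big_mkcond /=; apply: eq_bigr => s _; case: ltnP => // rs.
by rewrite coef_marks_poly_lt// mulr0.
Qed.

Lemma exp_coef0 (R : numFieldType) (V : nmodType) (e : nat -> V) k (c : R)
    (phi : V -> R) : exp_coef e k c 0 phi = phi 0.
Proof. by rewrite /exp_coef big_ord1 expr0 fact0 divr1 mul1r /= coefC. Qed.

(** Coefficientwise form of the differential equation F' = c h' F. *)
Lemma exp_coefS (R : numFieldType) (V : nmodType) (e : nat -> V) k (c : R) r
    (phi : V -> R) :
  r.+1%:R * exp_coef e k c r.+1 phi =
  c * \sum_(j < k | (j <= r)%N) exp_coef e k c (r - j) (shift_cycle e j phi).
Proof.
rewrite /exp_coef mulr_sumr big_ord_recl /= coefC /= mulr0 mulr0 add0r.
under eq_bigr => s _.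
  rewrite /bump /= add1n mulrCA [r.+1%:R * _]mulr_natl -coef_deriv deriv_marks_poly.
  rewrite coefZ mulrA factS natrM invfM mulrA.
  rewrite (_ : c ^+ s.+1 / s.+1%:R / s`!%:R * s.+1%:R = c * (c ^+ s / s`!%:R)); last first.
    by rewrite mulrAC mulfVK ?pnatr_eq0// exprS mulrA.
  rewrite -mulrA coef_sum big_distrr /=.
  over.
rewrite -mulr_sumr exchange_big /= [in RHS]big_mkcond; congr (_ * _).
apply: eq_bigr => j _; case: leqP => jr; last first.
  by apply: big1 => s _; rewrite coefXnM jr mulr0.
rewrite -/(exp_coef e k c (r - j) (shift_cycle e j phi)).
rewrite (@exp_coef_widen _ _ _ _ _ _ _ r.+1) ?ltnS ?leq_subr//.
by apply: eq_bigr => s _; rewrite coefXnM ltnNge jr.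
Qed.

Lemma sum_conv_shift (R : pzSemiRingType) (F G : nat -> R) n j : (j <= n)%N ->
  \sum_(r < n.+1 | (j <= r)%N) F (r - j)%N * G (n - r)%N =
  \sum_(r < (n - j).+1) F r * G (n - j - r)%N.
Proof.
move=> jn; rewrite -(big_geq_mkord _ _ xpredT (fun r => F (r - j)%N * G (n - r)%N)).
rewrite -{1}[j]add0n big_addn big_mkord subSn//.
by apply: eq_bigr => i _; rewrite addnK addnC subnDA.
Qed.

(** The coefficients of exp (- h(z)); the statistic is trivial here. *)
Definition no_short_diff (R : numFieldType) k m : R :=
  exp_coef (fun=> 0%N) k (-1) m (fun=> 1).

(** The coefficients of exp (- h(z)) / (1 - z), that is, the probability that a
    uniform permutation of [m] points has no cycle of length at most [k]. *)
Definition no_short (R : numFieldType) k m : R :=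
  \sum_(i < m.+1) no_short_diff R k i.

Lemma no_short_diff0 (R : numFieldType) k : no_short_diff R k 0 = 1.
Proof. exact: exp_coef0. Qed.

Lemma no_short_diffS (R : numFieldType) k m : m.+1%:R * no_short_diff R k m.+1 =
  - \sum_(j < k | (j <= m)%N) no_short_diff R k (m - j).
Proof. by rewrite /no_short_diff exp_coefS mulN1r. Qed.

Lemma no_short_recr (R : numFieldType) k m :
  no_short R k m.+1 = no_short R k m + no_short_diff R k m.+1.
Proof. exact: big_ord_recr. Qed.

Lemma no_short0 (R : numFieldType) k : no_short R k 0 = 1.
Proof. by rewrite /no_short big_ord1 no_short_diff0. Qed.

(** The window sum in [no_short_diffS] telescopes. *)
Lemma no_short_diff_lag (R : numFieldType) k m : m.+1%:R * no_short_diff R k m.+1 =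
  (if (k <= m)%N then no_short R k (m - k) else 0) - no_short R k m.
Proof.
rewrite no_short_diffS /no_short; case: leqP => km; last first.
  rewrite sub0r; congr (- _); rewrite [RHS](reindex_inj rev_ord_inj) /=.
  rewrite (big_ord_widen k (fun j => no_short_diff R k (m.+1 - j.+1)%N))//.
rewrite -[\sum_(_ < m.+1) _](big_mkord xpredT (no_short_diff R k)).
rewrite (big_cat_nat _ (n := (m - k).+1)) ?ltnS ?leq_subr//= big_mkord opprD addNKr.
congr (- _); rewrite -{1}[(m - k).+1]add0n big_addn big_mkord subSS subKn//.
rewrite [RHS](reindex_inj rev_ord_inj) /=; apply: eq_big => i.
  by rewrite (leq_trans _ km) // ltnW.
by move=> _; congr no_short_diff; have := ltn_ord i; lia.
Qed.

(** The cycle of a given point, uniform in length, has to be longer than [k]. *)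
Lemma no_short_sum (R : numFieldType) k m : m%:R * no_short R k m =
  \sum_(i < m - k) no_short R k i.
Proof.
elim: m => [|m IHm]; first by rewrite mul0r sub0n big_ord0.
rewrite no_short_recr mulrDr no_short_diff_lag -natr1 mulrDl mul1r IHm addrACA subrr addr0.
case: leqP => km; first by rewrite subSn// big_ord_recr.
by rewrite addr0 (eqP (ltnW km : (m - k)%N == 0%N)) (eqP (km : (m.+1 - k)%N == 0%N)) big_ord0.
Qed.

Lemma no_short_sum_long (R : numFieldType) k m : m.+1%:R * no_short R k m.+1 =
  \sum_(j < m.+1 | (k <= j)%N) no_short R k (m - j).
Proof.
rewrite no_short_sum -(big_geq_mkord _ _ xpredT (fun j => no_short R k (m - j)%N)).
rewrite -[X in index_iota X]add0n big_addn big_mkord (reindex_inj rev_ord_inj) /=.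
by apply: eq_bigr => i _; congr no_short; have := ltn_ord i; lia.
Qed.

(** A permutation of [n] points splits into its short cycles, covering [r] points,
    and a permutation of the other points without short cycles. *)
Definition perm_mean (R : numFieldType) (V : nmodType) (e : nat -> V) k n
    (phi : V -> R) : R :=
  \sum_(r < n.+1) exp_coef e k 1 r phi * no_short R k (n - r).

Lemma perm_mean0 (R : numFieldType) (V : nmodType) (e : nat -> V) k (phi : V -> R) :
  perm_mean e k 0 phi = phi 0.
Proof. by rewrite /perm_mean big_ord1 exp_coef0 no_short0 mulr1. Qed.

(** Both factors of the convolution satisfy a recurrence of the required type;
    the first one produces the cycle lengths up to [k] and the second one the
    longer lengths, for which the shift is trivial. *)
Lemma perm_meanS (R : numFieldType) (V : nmodType) (e : nat -> V) k n (phi : V -> R) :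
    (forall j, (k < j)%N -> e j = 0) ->
  n.+1%:R * perm_mean e k n.+1 phi =
  \sum_(j < n.+1) perm_mean e k (n - j) (shift_cycle e j phi).
Proof.
move=> ek; pose B r (psi : V -> R) := exp_coef e k 1 r psi.
have shiftk j : (k <= j)%N -> shift_cycle e j phi = phi.
  by move=> kj; apply/funext => v; rewrite /shift_cycle ek// add0r.
rewrite /perm_mean mulr_sumr.
have -> : \sum_(r < n.+2) n.+1%:R * (B r phi * no_short R k (n.+1 - r)) =
   \sum_(r < n.+1) \sum_(j < n.+1 | (j <= r)%N && (j < k)%N)
      B (r - j)%N (shift_cycle e j phi) * no_short R k (n - r) +
   \sum_(r < n.+1) \sum_(j < n.+1 | (j <= n - r)%N && (k <= j)%N)
      B r phi * no_short R k (n - r - j).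
  have -> : \sum_(r < n.+2) n.+1%:R * (B r phi * no_short R k (n.+1 - r)) =
    \sum_(r < n.+2) (r%:R * B r phi) * no_short R k (n.+1 - r) +
    \sum_(r < n.+2) B r phi * ((n.+1 - r)%:R * no_short R k (n.+1 - r)).
    rewrite -big_split /=; apply: eq_bigr => r _.
    have rn : (r <= n.+1)%N by rewrite -ltnS.
    rewrite [in RHS]mulrCA -[r%:R * _ * _]mulrA -mulrDl -natrD subnKC//.
  congr (_ + _).
    rewrite big_ord_recl mul0r mul0r add0r; apply: eq_bigr => r _.
    rewrite lift0 subSS /B exp_coefS mul1r mulr_suml.
    rewrite (big_ord_widen_cond (maxn k n.+1) (fun j => (j <= r)%N)
       (fun j => exp_coef e k 1 (r - j) (shift_cycle e j phi) * no_short R k (n - r))) ?leq_maxl//.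
    rewrite [RHS](big_ord_widen_cond (maxn k n.+1) (fun j => (j <= r)%N && (j < k)%N)
       (fun j => exp_coef e k 1 (r - j) (shift_cycle e j phi) * no_short R k (n - r))) ?leq_maxr//.
    by apply: eq_bigl => j /=; have := ltn_ord r; lia.
  rewrite big_ord_recr /= subnn mul0r mulr0 addr0; apply: eq_bigr => r _.
  have rn : (r <= n)%N by rewrite -ltnS.
  rewrite subSn// no_short_sum_long mulr_sumr.
  rewrite (big_ord_widen_cond n.+1 (fun j => (k <= j)%N)
       (fun j => B r phi * no_short R k (n - r - j))) ?ltnS ?leq_subr//.
  by apply: eq_bigl => j; rewrite ltnS andbC.
rewrite [X in X + _](exchange_big_dep predT) //= [X in _ + X](exchange_big_dep predT) //=.
rewrite -big_split /=; apply: eq_bigr => j _.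
have jn : (j <= n)%N by rewrite -ltnS.
case: (ltnP j k) => kj.
  rewrite [X in _ + X]big1 ?addr0 => [|r]; last by rewrite andbF.
  under eq_bigl do rewrite andbT.
  by rewrite (sum_conv_shift (B ^~ (shift_cycle e j phi)) (no_short R k)).
rewrite [X in X + _]big1 ?add0r => [|r]; last by rewrite andbF.
rewrite shiftk//.
rewrite (big_ord_widen n.+1 (fun r => B r phi * no_short R k (n - j - r))) ?ltnS ?leq_subr//.
apply: eq_big => [r|r _]; last by rewrite -!subnDA addnC.
rewrite andbT; have rn : (r <= n)%N by rewrite -ltnS.
by rewrite ltnS !leq_subRL// addnC.
Qed.

(** * Permutations without short cycles *)

Lemma no_short_ge0 (R : realFieldType) k m : 0 <= no_short R k m.
Proof.
elim/ltn_ind: m => -[|m] IHm; first by rewrite no_short0.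
rewrite -(pmulr_rge0 _ (ltr0Sn R m)) no_short_sum; apply: sumr_ge0 => i _.
by apply: IHm; rewrite (leq_trans (ltn_ord i))// leq_subr.
Qed.

(** In [no_short_sum] all terms but the first are, inductively, at most 1/(k+1);
    the first term, 1, is worth [k.+1] of them, and so the [m - k] terms together
    are worth at most [m] of them. *)
Lemma no_short_le (R : realFieldType) k m : (0 < m)%N -> no_short R k m <= k.+1%:R^-1.
Proof.
elim/ltn_ind: m => m IHm m0; rewrite -(ler_pM2l (_ : 0 < m%:R)) ?ltr0n// no_short_sum.
case mk : (m - k)%N => [|d]; first by rewrite big_ord0 mulr_ge0 ?invr_ge0.
rewrite big_ord_recl no_short0.
have dm : (d.+1 <= m)%N by rewrite -mk leq_subr.
apply: (@le_trans _ _ (1 + \sum_(i < d) k.+1%:R^-1)).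
  rewrite lerD2l; apply: ler_sum => i _; apply: IHm => //.
  by rewrite lift0 (leq_trans _ dm)// ltnS.
rewrite sumr_const card_ord -{1}(divff (_ : k.+1%:R != 0 :> R)) ?pnatr_eq0//.
rewrite -[_ *+ d]mulr_natl -mulrDl ler_wpM2r ?invr_ge0//.
by rewrite -natrD ler_nat; lia.
Qed.

(** From [k.+2] on, both terms of [no_short_diff_lag] lie between 0 and 1/(k+1);
    dividing by the index gives the second factor. *)
Lemma no_short_diff_le1 (R : realFieldType) k m : (k.+2 <= m)%N ->
  `|no_short_diff R k m| <= (k.+1%:R ^+ 2)^-1.
Proof.
case: m => // m km.
have kp : 0 < k.+1%:R :> R by [].
have mp : 0 < m.+1%:R :> R by [].
have : `|m.+1%:R * no_short_diff R k m.+1| <= k.+1%:R^-1.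
  rewrite no_short_diff_lag (_ : (k <= m)%N = true); last by lia.
  have := no_short_ge0 R k m; have := no_short_ge0 R k (m - k).
  have := @no_short_le R k m; have := @no_short_le R k (m - k).
  move=> /(_ ltac:(lia)) + /(_ ltac:(lia)).
  move: (_^-1) (no_short R k _) (no_short R k _) => c x y *.
  by rewrite ler_norml; apply/andP; split; lra.
rewrite normrM ger0_norm ?ler0n// => H.
rewrite -(ler_pM2l kp) expr2 invfM mulrA divff ?pnatr_eq0// mul1r.
apply: le_trans H; rewrite ler_wpM2r// ler_nat; lia.
Qed.

(** Up to sign, an increment is k/m times the average of the [k] preceding ones,
    and k/m is at most 1/q once [m] has reached [q * k]. *)
Lemma no_short_diff_le (R : realFieldType) k q m : (0 < k)%N -> (0 < q)%N ->
  (q * k + 2 <= m)%N -> `|no_short_diff R k m| <= (k.+1%:R ^+ 2 * q`!%:R)^-1.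
Proof.
move=> k0; elim: q m => // -[_ m _|q IHq [|m] _ km].
- rewrite mul1n addn2 (_ : 1`! = 1%N)// mulr1; exact: no_short_diff_le1.
- by rewrite addn2 in km.
have IH := IHq _ isT.
set D := (k.+1%:R ^+ 2 * q.+1`!%:R)^-1 in IH.
have D0 : 0 <= D by rewrite invr_ge0 mulr_ge0// exprn_ge0.
have : `|m.+1%:R * no_short_diff R k m.+1| <= k%:R * D.
  rewrite no_short_diffS normrN; apply: le_trans (ler_norm_sum _ _ _) _.
  apply: (@le_trans _ _ (\sum_(j < k | (j <= m)%N) D)).
    apply: ler_sum => j _; apply: IH; have := ltn_ord j; move: km; rewrite !mulSn; lia.
  rewrite mulr_natl -[k in leRHS]card_ord -sumr_const.
  rewrite [leRHS](bigID (fun j : 'I_k => (j <= m)%N)) /=.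
  by rewrite lerDl sumr_ge0.
rewrite normrM ger0_norm ?ler0n// => H.
rewrite factS natrM mulrCA invfM -/D.
rewrite -(ler_pM2l (_ : 0 < q.+2%:R)) // mulrA divff ?pnatr_eq0// mul1r.
rewrite -(ler_pM2l (_ : 0 < k%:R)) ?ltr0n//; apply: le_trans H.
rewrite mulrA ler_wpM2r// -natrM ler_nat; lia.
Qed.

Lemma no_short_segment (R : realFieldType) k q m d : (0 < k)%N -> (0 < q)%N ->
  (q * k + 1 <= m)%N -> (d <= k)%N ->
  no_short R k (m + d) - no_short R k m <= (k.+1%:R * q`!%:R)^-1.
Proof.
move=> k0 q0 qm dk; set D := (k.+1%:R ^+ 2 * q`!%:R)^-1 : R.
have D0 : 0 <= D by rewrite invr_ge0 mulr_ge0// exprn_ge0.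
have H : no_short R k (m + d) - no_short R k m <= d%:R * D.
  elim: d {dk} => [|d IHd]; first by rewrite addn0 subrr mul0r.
  rewrite addnS no_short_recr -natr1 mulrDl mul1r addrAC lerD//.
  apply: le_trans (ler_norm _) _; apply: no_short_diff_le => //; lia.
apply: le_trans H _; apply: (@le_trans _ _ (k.+1%:R * D)).
  by rewrite ler_wpM2r// ler_nat leqW.
by rewrite /D expr2 -mulrA invfM mulrA divff ?pnatr_eq0// mul1r.
Qed.

(** The tail of the increments is dominated by its first block, since the block
    bounds decrease at least geometrically with ratio 1/2. *)
Lemma no_short_osc (R : realFieldType) k q m M : (0 < k)%N -> (0 < q)%N ->
  (q * k + 1 <= m)%N -> (m <= M)%N ->
  no_short R k M - no_short R k m <= 2 * (k.+1%:R * q`!%:R)^-1.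
Proof.
move=> k0 + + mM; have [t] : exists t, (M <= m + t * k)%N.
  by exists M; rewrite -[X in (X <= _)%N]add0n leq_add// leq_pmulr.
elim: t q m mM => [|t IHt] q m mM.
  rewrite mul0n addn0 => Mm q0 qm.
  have -> : M = m by apply/eqP; rewrite eqn_leq Mm.
  by rewrite subrr mulr_ge0// invr_ge0 mulr_ge0.
move=> Mm q0 qm; case: (leqP M (m + k)) => Mk.
  apply: le_trans (_ : (k.+1%:R * q`!%:R)^-1 <= _); last first.
    by rewrite ler_peMl ?invr_ge0 ?mulr_ge0// ler1n.
  have -> : M = (m + (M - m))%N by rewrite subnKC.
  by apply: no_short_segment => //; lia.
have := IHt q.+1 (m + k)%N (ltnW Mk) ltac:(rewrite mulSn addnA in Mm; exact: Mm) isT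
   ltac:(rewrite mulSn; lia).
have := @no_short_segment R k q m k k0 q0 qm (leqnn _).
rewrite (_ : (k.+1%:R * q.+1`!%:R)^-1 = q.+1%:R^-1 * (k.+1%:R * q`!%:R)^-1 :> R); last first.
  by rewrite factS natrM mulrCA invfM.
set D := (_ * _)^-1.
have D0 : 0 <= D by rewrite invr_ge0 mulr_ge0.
have : q.+1%:R^-1 * D <= 2^-1 * D.
  by rewrite ler_wpM2r// lef_pV2 ?posrE// ler_nat.
move: (q.+1%:R^-1 * D) => E *; lra.
Qed.

(** * Exponential sums and the mass of the generating polynomials *)

Definition exp_sum (R : realType) (x : R) M : R := \sum_(s < M) x ^+ s / s`!%:R.

Lemma exp_sumE (R : realType) (x : R) : exp_sum x = series (exp_coeff x).
Proof. by apply/funext => M; rewrite /exp_sum /series /= big_mkord. Qed.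

Lemma cvg_exp_sum (R : realType) (x : R) : exp_sum x @ \oo --> expR x.
Proof. by rewrite exp_sumE; apply: is_cvg_series_exp_coeff. Qed.

Lemma exp_sum_le (R : realType) (x : R) M : 0 <= x -> exp_sum x M <= expR x.
Proof.
move=> x0; rewrite exp_sumE; apply: nondecreasing_cvgn_le.
  by apply: nondecreasing_series => i _ _; exact: exp_coeff_ge0.
exact: is_cvg_series_exp_coeff.
Qed.

(** Used as 1 / q! <= e^x x^(-q). *)
Lemma exp_term_le (R : realType) (x : R) s : 0 <= x -> x ^+ s / s`!%:R <= expR x.
Proof.
move=> x0; apply: le_trans (exp_sum_le s.+1 x0); rewrite /exp_sum big_ord_recr /=.
by rewrite lerDr sumr_ge0// => i _; rewrite mulr_ge0 ?exprn_ge0 ?invr_ge0.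
Qed.

(** The value h(v); h(1) is the harmonic number. *)
Definition harm (R : numFieldType) k (v : R) : R := \sum_(j < k) v ^+ j.+1 / j.+1%:R.

Section marks.
Variables (R : realFieldType) (V : nmodType) (e : nat -> V) (k : nat).
Implicit Types phi : V -> R.

Lemma horner_marks_poly1 s (v : R) : (marks_poly e k s (fun=> 1)).[v] = harm k v ^+ s.
Proof.
elim: s => [|s IHs]; first by rewrite /= hornerC.
rewrite marks_polyS horner_sum exprS /harm mulr_suml; apply: eq_bigr => j _.
by rewrite hornerZ hornerM hornerXn /shift_cycle IHs mulrCA mulrA.
Qed.

Lemma coef_marks_poly_ge0 s phi r : (forall v, 0 <= phi v) ->
  0 <= (marks_poly e k s phi)`_r.
Proof.
elim: s phi r => [|s IHs] phi r phi0.
  by rewrite /= coefC; case: eqP.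
rewrite marks_polyS coef_sum sumr_ge0// => j _; rewrite coefZ coefXnM.
by rewrite mulr_ge0 ?invr_ge0//; case: ifP => // _; apply: IHs => v; apply: phi0.
Qed.

Lemma size_marks_poly s phi : (size (marks_poly e k s phi) <= (k * s).+1)%N.
Proof.
elim: s phi => [|s IHs] phi; first by rewrite muln0 size_polyC leq_b1.
rewrite marks_polyS; apply: leq_trans (size_sum _ _ _) _.
apply/bigmax_leqP => j _; apply: leq_trans (size_scale_leq _ _) _.
apply: leq_trans (size_polyMleq _ _) _; rewrite size_polyXn /=.
have := IHs (shift_cycle e j phi); have := ltn_ord j; rewrite mulnS; move: (size _) => N; lia.
Qed.

Lemma sum_coef_marks_poly s phi v N : (k * s < N)%N ->
  \sum_(r < N) (marks_poly e k s phi)`_r * v ^+ r = (marks_poly e k s phi).[v].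
Proof.
by move=> kN; rewrite (@horner_coef_wide _ N)//; apply: leq_trans (size_marks_poly _ _) _.
Qed.

Lemma sum_coef_marks_poly_le s phi v N : (forall v, 0 <= phi v) -> 0 <= v ->
  \sum_(r < N) (marks_poly e k s phi)`_r * v ^+ r <= (marks_poly e k s phi).[v].
Proof.
move=> phi0 v0; rewrite -(@sum_coef_marks_poly s phi v (maxn N (k * s).+1)) ?leq_maxr//.
rewrite (big_ord_widen (maxn N (k * s).+1)
  (fun r => (marks_poly e k s phi)`_r * v ^+ r)) ?leq_maxl//.
rewrite [leRHS](bigID (fun r : 'I__ => (r < N)%N)) /= lerDl sumr_ge0// => r _.
by rewrite mulr_ge0 ?coef_marks_poly_ge0 ?exprn_ge0.
Qed.

Lemma exp_coef_ge0 r phi : (forall v, 0 <= phi v) -> 0 <= exp_coef e k 1 r phi.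
Proof.
move=> phi0; apply: sumr_ge0 => s _; rewrite expr1n div1r mulr_ge0 ?invr_ge0//.
exact: coef_marks_poly_ge0.
Qed.

Lemma marks_poly_mono s phi psi r : (forall v, phi v <= psi v) ->
  (marks_poly e k s phi)`_r <= (marks_poly e k s psi)`_r.
Proof.
elim: s phi psi r => [|s IHs] phi psi r pp.
  by rewrite /= !coefC; case: eqP.
rewrite !marks_polyS !coef_sum ler_sum// => j _; rewrite !coefZ !coefXnM.
by rewrite ler_wpM2l ?invr_ge0//; case: ifP => // _; apply: IHs => v; apply: pp.
Qed.

Lemma exp_coef_mono r phi psi : (forall v, phi v <= psi v) ->
  exp_coef e k 1 r phi <= exp_coef e k 1 r psi.
Proof.
move=> pp; apply: ler_sum => s _; rewrite expr1n ler_wpM2l ?invr_ge0//.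
exact: marks_poly_mono.
Qed.

End marks.

(** * The quantitative comparison *)

Lemma harm1S (R : numFieldType) k : harm k.+1 1 = harm k 1 + k.+1%:R^-1 :> R.
Proof. by rewrite /harm big_ord_recr /= expr1n div1r. Qed.

Lemma harm1_ge0 (R : numFieldType) k : 0 <= harm k 1 :> R.
Proof. by apply: sumr_ge0 => j _; rewrite expr1n mulr_ge0 ?invr_ge0. Qed.

Lemma expR_harm1_ge (R : realType) k : k.+1%:R <= expR (harm k 1) :> R.
Proof.
elim: k => [|k IHk]; first by rewrite /harm big_ord0 expR0.
rewrite harm1S expRD.
apply: (@le_trans _ _ (k.+1%:R * (1 + k.+1%:R^-1))).
  by rewrite mulrDr mulr1 divff ?pnatr_eq0// natr1.
by apply: ler_pM; rewrite ?addr_ge0 ?invr_ge0 ?expR_ge1Dx.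
Qed.

Lemma expR_harm1_le (R : realType) k : (0 < k)%N ->
  expR (harm k 1) <= expR 1 * k%:R :> R.
Proof.
case: k => // k _; elim: k => [|k IHk].
  by rewrite harm1S /harm big_ord0 add0r invr1 mulr1.
rewrite harm1S expRD; apply: le_trans (ler_wpM2r (expR_ge0 _) IHk) _.
rewrite -mulrA ler_wpM2l ?expR_ge0//.
rewrite -ler_pdivlMr ?expR_gt0// -expRN.
apply: le_trans (ler_wpM2l (ler0n _ _) (expR_ge1Dx _)).
by rewrite mulrBr mulr1 divff ?pnatr_eq0// -[k.+2%:R]natr1 addrK.
Qed.

Lemma expR_Nharm1_le (R : realType) k : expR (- harm k 1) <= k.+1%:R^-1 :> R.
Proof. by rewrite expRN lef_pV2 ?posrE ?expR_gt0// expR_harm1_ge. Qed.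

(** The partial sum of the coefficients of exp (- h) and the exponential partial
    sum at -H differ only in the powers h^s with [s > M], whose total is bounded
    by the remainder of exp H. *)
Lemma no_short_ge_exp (R : realType) k M : (0 < k)%N ->
  exp_sum (- harm k 1) M.+1 + exp_sum (harm k 1) M.+1 - expR (harm k 1)
   <= no_short R k (k * M).
Proof.
move=> k0; set H : R := harm k 1; set N := (k * M)%N.
have H0 : 0 <= H by exact: harm1_ge0.
have MN : (M.+1 <= N.+1)%N by rewrite ltnS leq_pmull.
apply: le_trans (_ : exp_sum (- H) M.+1 + exp_sum H M.+1 - exp_sum H N.+1 <= _).
  by rewrite lerD2l lerN2 exp_sum_le.
rewrite /exp_sum (big_ord_widen _ (fun s => (- H) ^+ s / s`!%:R) MN).
rewrite (big_ord_widen _ (fun s => H ^+ s / s`!%:R) MN).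
rewrite big_mkcond [X in _ + X - _]big_mkcond -big_split -sumrB /=.
rewrite /no_short /no_short_diff.
under [leRHS]eq_bigr => i _.
  rewrite (@exp_coef_widen _ _ _ _ _ _ _ N.+1)//; over.
rewrite exchange_big /=; apply: ler_sum => s _; rewrite -mulr_sumr.
have [sM|sM] := leqP s.+1 M.+1.
  have : (k * s < N.+1)%N by rewrite ltnS leq_pmul2l.
  move=> /(sum_coef_marks_poly (fun=> 0%N) (fun=> 1 : R) 1).
  rewrite horner_marks_poly1 -/H; under eq_bigr do rewrite expr1n mulr1.
  by move=> ->; rewrite addrK exprNn mulrAC.
rewrite add0r sub0r.
have /= := sum_coef_marks_poly_le (fun=> 0%N) k s N.+1 (fun=> ler01 : 0 <= 1 :> R) (ler01 : 0 <= 1 :> R).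
rewrite horner_marks_poly1 -/H; under eq_bigr do rewrite expr1n mulr1.
set W := \sum_(_ < _) _ => WH.
have W0 : 0 <= W by apply: sumr_ge0 => i _; exact: coef_marks_poly_ge0.
rewrite lerNl -mulrN; apply: le_trans (ler_norm _) _.
rewrite normrM normrN normrM normrX normrN1 expr1n mul1r ger0_norm ?invr_ge0//.
by rewrite ger0_norm// mulrC ler_wpM2r ?invr_ge0.
Qed.

(** The limit is e^(-H), so bounds on the oscillation bound the distance to it. *)
Lemma no_short_limit (R : realType) k m (eta : R) : (0 < k)%N ->
  (forall M, (m <= M)%N -> no_short R k M - no_short R k m <= eta) ->
  expR (- harm k 1) - no_short R k m <= eta.
Proof.
move=> k0 Hm; rewrite lerBlDr; set H : R := harm k 1.
have H1 : exp_sum (- H) M.+1 + exp_sum H M.+1 - expR H @[M --> \oo] --> expR (- H).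
  rewrite -[expR (- H)](addrK (expR H)).
  apply: cvgB; last exact: cvg_cst.
  by apply: cvgD; [rewrite (cvg_shiftS (exp_sum (- H))) | rewrite (cvg_shiftS (exp_sum H))];
    exact: cvg_exp_sum.
apply: (cvgr_to_le H1).
exists m => // M /= mM; apply: le_trans (no_short_ge_exp _ _ _) _ => //.
by rewrite -lerBlDr Hm// (leq_trans mM) ?leq_pmull.
Qed.

(** The bound with a factorial, made exponential in [m] so that it can be summed
    against the generating function of the short cycles.  For [m <= k] it only
    uses that e^(-H) is at most 1/(k+1). *)
Lemma no_short_lower (R : realType) k (v : R) m : (0 < k)%N -> 1 <= v ->
  expR (- harm k 1) - no_short R k m
   <= 2 * k.+1%:R^-1 * (expR (v ^+ k) * v ^+ k) * v ^- m.
Proof.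
move=> k0 v1; have v0 : 0 < v by exact: lt_le_trans v1.
have uE : 1 <= expR (v ^+ k) by rewrite -expR0 ler_expR exprn_ge0// ltW.
case: (leqP m k) => mk.
  apply: (@le_trans _ _ k.+1%:R^-1).
    apply: le_trans (expR_Nharm1_le R k).
    by rewrite lerBlDr lerDl no_short_ge0.
  rewrite [2 * _]mulrC -!mulrA ler_peMr ?invr_ge0//.
  have : 1 <= v ^+ k * v ^- m by rewrite ler_pdivlMr ?exprn_gt0// mul1r ler_weXn2l.
  move: (v ^+ k * v ^- m) (expR _) uE => a c c1 a1.
  have : 1 <= c * a by rewrite mulr_ege1.
  lra.
(* The largest [q] for which the oscillation bound applies at [m]. *)
pose q := (m.-1 %/ k)%N.
have q0 : (0 < q)%N by rewrite divn_gt0//; lia.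
have qm : (q * k + 1 <= m)%N by rewrite addn1; have := leq_trunc_div m.-1 k; rewrite -/q; lia.
have mq : (m <= q * k + k)%N.
  by have := ltn_ceil m.-1 k0; rewrite -/q mulSn; lia.
apply: (@le_trans _ _ (2 * (k.+1%:R * q`!%:R)^-1)).
  by apply: no_short_limit => // M mM; exact: no_short_osc.
rewrite invfM mulrA -[leRHS]mulrA ler_wpM2l ?mulr_ge0 ?invr_ge0//.
have A : q`!%:R^-1 <= expR (v ^+ k) * v ^- (k * q).
  rewrite ler_pdivlMr ?exprn_gt0// mulrC exprM.
  by apply: exp_term_le; rewrite exprn_ge0// ltW.
have B : v ^- (k * q) <= v ^+ k * v ^- m.
  rewrite ler_pdivlMr ?exprn_gt0// mulrC ler_pdivrMr ?exprn_gt0// -exprD.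
  by rewrite ler_weXn2l// addnC mulnC.
by apply: le_trans A _; rewrite -mulrA ler_wpM2l ?expR_ge0.
Qed.

(** By convexity (v^j - 1) / j is at most (v^k - 1) / k.  This keeps the factor
    e^(H_k) apart, which is compensated by the [1/(k+1)] of [no_short_lower]. *)
Lemma harm_le (R : realFieldType) k (v : R) : (0 < k)%N -> 1 <= v ->
  harm k v <= harm k 1 + (v ^+ k - 1).
Proof.
move=> k0 v1; rewrite /harm -lerBlDl -sumrB.
apply: (@le_trans _ _ (\sum_(j < k) (v ^+ k - 1) / k%:R)); last first.
  by rewrite sumr_const card_ord -[_ *+ k]mulr_natr divfK// pnatr_eq0 -lt0n.
apply: ler_sum => -[j /= jk] _; rewrite -mulrBl expr1n.
rewrite ler_pdivrMr ?ltr0n// mulrAC ler_pdivlMr ?ltr0n//.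
rewrite !subrX1 -!mulrA ler_wpM2l ?subr_ge0//.
have -> : (k = j.+1 + (k - j.+1))%N by rewrite subnKC.
move: (k - j.+1)%N => d {k k0 jk}.
rewrite -(big_mkord xpredT (fun i => v ^+ i)) -(big_mkord xpredT (fun i => v ^+ i)).
rewrite [in leRHS](big_cat_nat _ (n := j.+1)) ?leq_addr//= mulrDl natrD mulrDr lerD2l.
set S := \sum_(0 <= i < j.+1) _.
have S1 : S <= j.+1%:R * v ^+ j.+1.
  apply: (@le_trans _ _ (\sum_(i < j.+1) v ^+ j.+1)).
    by rewrite /S big_mkord; apply: ler_sum => i _; rewrite ler_weXn2l// ltnW.
  by rewrite sumr_const card_ord mulr_natl.
have S2 : d%:R * v ^+ j.+1 <= \sum_(j.+1 <= i < j.+1 + d) v ^+ i.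
  apply: (@le_trans _ _ (\sum_(i < d) v ^+ j.+1)).
    by rewrite sumr_const card_ord mulr_natl.
  rewrite -[X in index_iota X]add0n big_addn addKn big_mkord.
  by apply: ler_sum => i _; rewrite ler_weXn2l// leq_addl.
apply: le_trans (ler_wpM2r (ler0n _ d) S1) _.
rewrite -mulrA mulrC [_ * d%:R]mulrC.
by rewrite ler_wpM2r.
Qed.

Section assembly.
Variables (R : realType) (V : nmodType) (e : nat -> V) (k : nat).
Hypothesis k0 : (0 < k)%N.

Lemma sum_exp_coef_le (v : R) N : 0 <= v ->
  \sum_(r < N) exp_coef e k 1 r (fun=> 1) * v ^+ r <= expR (harm k v).
Proof.
move=> v0; have h0 : 0 <= harm k v.
  by apply: sumr_ge0 => j _; rewrite mulr_ge0 ?invr_ge0 ?exprn_ge0.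
apply: le_trans (exp_sum_le N h0); rewrite /exp_sum.
under eq_bigr => r _.
  rewrite (@exp_coef_widen _ _ _ _ _ _ _ N)// mulr_suml; over.
rewrite exchange_big /=; apply: ler_sum => s _.
under eq_bigr do rewrite expr1n div1r -mulrA.
rewrite -mulr_sumr mulrC ler_wpM2r ?invr_ge0//.
by rewrite -(horner_marks_poly1 e); apply: sum_coef_marks_poly_le.
Qed.

(** The coefficients of the first [M] powers of h are exhausted by the degrees up
    to [k * M], and the other terms are nonnegative. *)
Lemma sum_marks_poly_le (phi : V -> R) M N : (forall v, 0 <= phi v) ->
  (k * M < N)%N ->
  \sum_(s < M) (marks_poly e k s phi).[1] / s`!%:R <= \sum_(r < N) exp_coef e k 1 r phi.
Proof.
move=> phi0 MN.
under [leRHS]eq_bigr => r _ do rewrite (@exp_coef_widen _ _ _ _ _ _ _ N)//.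
rewrite exchange_big /=.
rewrite (big_ord_widen N (fun s => (marks_poly e k s phi).[1] / s`!%:R)); last first.
  by apply: leq_trans (ltnW MN); rewrite leq_pmull.
rewrite big_mkcond; apply: ler_sum => s _; case: ltnP => sM; last first.
  by apply: sumr_ge0 => r _; rewrite expr1n div1r mulr_ge0 ?invr_ge0 ?coef_marks_poly_ge0.
rewrite -mulr_sumr expr1n div1r mulrC ler_wpM2l ?invr_ge0//.
rewrite -(@sum_coef_marks_poly _ _ e k s phi 1 N); last first.
  by apply: leq_ltn_trans MN; rewrite leq_mul2l (ltnW sM) orbT.
by apply: ler_sum => r _; rewrite expr1n mulr1.
Qed.

(** Termwise comparison of the two expansions; for [r > n] the term of the
    permutation side is missing, and the bound e^(-H) suffices. *)
Lemma perm_mean_lower (phi : V -> R) (v : R) n M : (forall a, 0 <= phi a <= 1) -> 1 <= v ->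
  expR (- harm k 1) * \sum_(s < M) (marks_poly e k s phi).[1] / s`!%:R
    - perm_mean e k n phi
  <= 2 * k.+1%:R^-1 * (expR (v ^+ k) * v ^+ k) * v ^- n * expR (harm k v).
Proof.
move=> phi01 v1; set E := 2 * _ * _ * _.
have v0 : 0 < v by exact: lt_le_trans v1.
have phi0 a : 0 <= phi a by have /andP[] := phi01 a.
have phi1 a : phi a <= 1 by have /andP[] := phi01 a.
have E0 : 0 <= E.
  by rewrite /E !mulr_ge0 ?invr_ge0 ?exprn_ge0 ?expR_ge0// ltW.
(* Large enough to contain the first [M] powers of h and the degrees up to [n]. *)
pose N := (k * M + n).+1.
have nN : (n.+1 <= N)%N by rewrite ltnS leq_addl.
have key r : expR (- harm k 1) - (if (r < n.+1)%N then no_short R k (n - r) else 0)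
    <= E * v ^+ r.
  case: ltnP => rn.
    apply: le_trans (no_short_lower _ k0 v1) _; rewrite /E -!mulrA.
    do 5?[rewrite ler_wpM2l ?invr_ge0 ?exprn_ge0 ?expR_ge0 ?(ltW v0)//].
    rewrite ler_pdivlMl ?exprn_gt0// ler_pdivrMr ?exprn_gt0//.
    by rewrite -exprD subnKC.
  rewrite subr0; apply: le_trans (expR_Nharm1_le R k) _; rewrite /E.
  rewrite [2 * _]mulrC -!mulrA ler_peMr ?invr_ge0//.
  have : 1 <= v ^- n * v ^+ r.
    by rewrite mulrC ler_pdivlMr ?exprn_gt0// mul1r ler_weXn2l// ltnW.
  have : 1 <= v ^+ k by rewrite exprn_ege1.
  have : 1 <= expR (v ^+ k) by rewrite -expR0 ler_expR exprn_ge0// ltW.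
  move: (v ^- n * v ^+ r) (v ^+ k) (expR _) => a b c c1 b1 a1.
  have : 1 <= c * (b * a) by rewrite !mulr_ege1.
  lra.
apply: le_trans (_ : \sum_(r < N) exp_coef e k 1 r phi * (E * v ^+ r) <= _); last first.
  under eq_bigr do rewrite mulrCA.
  rewrite -mulr_sumr ler_wpM2l//; apply: le_trans (sum_exp_coef_le N (ltW v0)).
  by apply: ler_sum => r _; rewrite ler_wpM2r ?exprn_ge0 ?(ltW v0)// exp_coef_mono.
apply: (@le_trans _ _ (expR (- harm k 1) * \sum_(r < N) exp_coef e k 1 r phi - perm_mean e k n phi)).
  by rewrite lerD2r ler_wpM2l ?expR_ge0// sum_marks_poly_le// ltnS leq_addr.
rewrite /perm_mean (big_ord_widen N (fun r => exp_coef e k 1 r phi * no_short R k (n - r)))//.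
rewrite [X in _ - X]big_mkcond mulr_sumr -sumrB /=; apply: ler_sum => r _.
apply: le_trans (ler_wpM2l (exp_coef_ge0 _ _ _ phi0) (key r)).
by rewrite mulrBr [_ * expR _]mulrC; case: ifP => //; rewrite mulr0.
Qed.
End assembly.

(** With v^k = x the factor v^(-n) becomes x^(-x), and the remaining ones are at
    most 2 e^(3 x). *)
Lemma perm_mean_lower_exp (R : realType) (V : nmodType) (e : nat -> V) (k n : nat)
    (phi : V -> R) M (x : R) : (0 < k)%N -> (k <= n)%N -> x = n%:R / k%:R ->
    (forall a, 0 <= phi a <= 1) ->
  expR (- harm k 1) * \sum_(s < M) (marks_poly e k s phi).[1] / s`!%:R
    - perm_mean e k n phi
  <= 2 * expR (3 * x - x * ln x).
Proof.
move=> k0 kn xE phi01.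
have kR : 0 < k%:R :> R by rewrite ltr0n.
have x1 : 1 <= x by rewrite xE ler_pdivlMr// mul1r ler_nat.
have x0 : 0 < x by exact: lt_le_trans x1.
pose v := expR (ln x / k%:R).
have v1 : 1 <= v by rewrite -expR0 ler_expR divr_ge0 ?ln_ge0.
have vk : v ^+ k = x.
  by rewrite -expRM_natl mulrC divfK ?gt_eqF// lnK.
have vn : v ^- n = expR (- (x * ln x)).
  rewrite /v -expRM_natl expRN; congr (expR _)^-1.
  by rewrite [X in _ = X * _]xE mulrAC mulrA.
apply: le_trans (perm_mean_lower e k0 n M phi01 v1) _; rewrite vk vn.
have hv : expR (harm k v) <= expR x * k.+1%:R.
  apply: (@le_trans _ _ (expR (harm k 1 + (x - 1)))).
    by rewrite ler_expR -vk harm_le.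
  rewrite addrC expRD expRB -mulrA ler_wpM2l ?expR_ge0//.
  rewrite ler_pdivrMl ?expR_gt0//; apply: le_trans (expR_harm1_le _ k0) _.
  by rewrite ler_wpM2l ?expR_ge0// ler_nat.
have xe : x <= expR x by apply: le_trans (expR_ge1Dx x); rewrite lerDr.
rewrite [3 * x - _]addrC expRD.
rewrite (_ : 3 * x = x + (x + x)); last by ring.
rewrite !expRD; set a := expR (- _); set b := expR x in hv xe *.
have a0 : 0 <= a := expR_ge0 _.
have b0 : 0 <= b := expR_ge0 _.
have hb : expR (harm k v) / k.+1%:R <= b by rewrite ler_pdivrMr.
have xb : x * (expR (harm k v) / k.+1%:R) <= b * b.
  by apply: ler_pM => //; rewrite ?mulr_ge0 ?expR_ge0 ?invr_ge0// ltW.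
apply: (@le_trans _ _ (2 * (a * (b * (x * (expR (harm k v) / k.+1%:R)))))).
  rewrite le_eqVlt; apply/orP; left; apply/eqP; rewrite -/b.
  by move: (k.+1%:R^-1) (expR (harm k v)) => c d; ring.
by rewrite !ler_wpM2l.
Qed.

(** * Independent Poisson variables *)

Lemma marks_poly0 (R : numFieldType) (V : nmodType) (e : nat -> V) k s :
  marks_poly e k s (fun=> 0 : R) = 0.
Proof.
elim: s => [|s IHs]; first by rewrite /= polyC0.
by rewrite marks_polyS big1// => j _; rewrite IHs mulr0 scaler0.
Qed.

Lemma marks_polyD (R : numFieldType) (V : nmodType) (e : nat -> V) k s
    (phi psi : V -> R) :
  marks_poly e k s (fun v => phi v + psi v) =
  marks_poly e k s phi + marks_poly e k s psi.
Proof.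
elim: s phi psi => [|s IHs] phi psi; first by rewrite /= polyCD.
rewrite !marks_polyS -big_split; apply: eq_bigr => j _ /=.
by rewrite -scalerDr -mulrDr -IHs.
Qed.

Section vector.
Variables (R : realType) (k m : nat) (I : 'I_m -> {fset nat}).
Hypothesis Ik : forall i j, j \in I i -> (1 <= j <= k)%N.
Hypothesis Idisj : forall i i', i != i' -> [disjoint I i & I i']%fset.

(** The statistic [cycle_stat class_vec] counts, for each class [I i], the cycles
    whose length belongs to it. *)
Definition class_vec (j : nat) : {ffun 'I_m -> nat} := [ffun i => (j \in I i) : nat].

Definition unit_vec (i : 'I_m) : {ffun 'I_m -> nat} := [ffun i' => (i' == i) : nat].

Lemma unit_vecD i (a : {ffun 'I_m -> nat}) i' :
  (unit_vec i + a) i' = ((i' == i) + a i')%N.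
Proof. by rewrite !ffunE. Qed.

Lemma class_vec_large j : (k < j)%N -> class_vec j = 0.
Proof.
move=> kj; apply/ffunP => i; rewrite !ffunE; case: (boolP (j \in I i)) => // /Ik.
by move=> /andP[_]; rewrite leqNgt kj.
Qed.

Lemma class_vec_in i j : j \in I i -> class_vec j = unit_vec i.
Proof.
move=> ji; apply/ffunP => i'; rewrite !ffunE.
case: eqVneq => [->|ii']; first by rewrite ji.
by have /fdisjointP := Idisj ii' => /(_ j)/contraTN; rewrite ji => /(_ isT) /negbTE ->.
Qed.

(** All the classes are summed over the common range of lengths up to [k], so that
    their weights can be compared with H_k. *)
Lemma harmonic_sumE (J : {fset nat}) : (forall j, j \in J -> (1 <= j <= k)%N) ->
  harmonic_sum R J = \sum_(j < k) (j.+1 \in J)%:R / j.+1%:R.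
Proof.
move=> Jk; rewrite /harmonic_sum.
under [RHS]eq_bigr do rewrite mulr_natl.
rewrite -[RHS](big_mkord xpredT (fun j => (j.+1%:R^-1 : R) *+ (j.+1 \in J))).
under [RHS]eq_bigr do rewrite mulrb.
rewrite -big_mkcond -(big_map S (mem J) (fun j => j%:R^-1)) -big_filter.
apply: perm_big; apply: uniq_perm.
- exact: fset_uniq.
- by rewrite filter_uniq// map_inj_uniq ?iota_uniq//; exact: succn_inj.
move=> j; rewrite mem_filter; apply/idP/andP => [jJ|[]//]; split=> //.
have := Jk _ jJ; case: j {jJ} => // j jk.
by rewrite mem_map; [rewrite mem_index_iota|exact: succn_inj].
Qed.

Let Hi i : R := harmonic_sum R (I i).
Let H0 : R := harm k 1 - \sum_i Hi i.

Definition marks_mass s (phi : {ffun 'I_m -> nat} -> R) : R :=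
  (marks_poly class_vec k s phi).[1].

(** At z = 1 only the class of a length matters: the lengths of class [i] have
    total weight H(I_i), and those of no class the remaining weight. *)
Lemma marks_massS s (phi : {ffun 'I_m -> nat} -> R) :
  marks_mass s.+1 phi = H0 * marks_mass s phi +
    \sum_i Hi i * marks_mass s (fun v => phi (unit_vec i + v)).
Proof.
rewrite {1}/marks_mass marks_polyS horner_sum.
have E (j : 'I_k) : marks_mass s (shift_cycle class_vec j phi) = marks_mass s phi +
    \sum_i (j.+1 \in I i)%:R * (marks_mass s (fun v => phi (unit_vec i + v)) - marks_mass s phi).
  have [/existsP[i ji]|/existsPn nj] := boolP [exists i, j.+1 \in I i].
    rewrite (bigD1 i)//= ji mul1r big1 ?addr0 => [|i' ii'].
      rewrite addrC subrK; congr marks_mass.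
      by apply/funext => v; rewrite /shift_cycle (class_vec_in ji).
    have /fdisjointP := Idisj ii' => /(_ j.+1)/contraTN; rewrite ji => /(_ isT) /negbTE ->.
    by rewrite mul0r.
  rewrite big1 ?addr0 => [|i _]; last by rewrite (negbTE (nj i)) mul0r.
  congr marks_mass; apply/funext => v; rewrite /shift_cycle.
  suff -> : class_vec j.+1 = 0 by rewrite add0r.
  by apply/ffunP => i; rewrite !ffunE (negbTE (nj i)).
under eq_bigr => j _.
  rewrite hornerZ hornerM hornerXn expr1n mul1r -/(marks_mass s _) E mulrDr mulr_sumr; over.
rewrite big_split /= exchange_big /=.
rewrite -mulr_suml /H0 mulrBl -addrA; congr (_ * _ + _).
  by apply: eq_bigr => j _; rewrite expr1n div1r.
rewrite mulr_suml -sumrN -big_split; apply: eq_bigr => i _ /=.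
rewrite /Hi harmonic_sumE; last exact: Ik.
rewrite addrC -mulrBr mulr_suml; apply: eq_bigr => j _.
by rewrite mulrCA mulrA.
Qed.

(** The value 0 for [b > s] makes the multinomial recurrence hold without side
    condition. *)
Definition exp_term_shift (h : R) s b := if (b <= s)%N then h ^+ (s - b) / (s - b)`!%:R else 0.

Lemma exp_termS (x : R) n :
  n.+1%:R * (x ^+ n.+1 / n.+1`!%:R) = x * (x ^+ n / n`!%:R).
Proof. by rewrite exprS factS natrM invfM mulrCA mulVKf ?pnatr_eq0// mulrA. Qed.

(** Pascal's rule, divided by factorials. *)
Lemma exp_term_shiftS h s b : s.+1%:R * exp_term_shift h s.+1 b =
  h * exp_term_shift h s b + b%:R * exp_term_shift h s b.-1.
Proof.
rewrite /exp_term_shift; case: (ltngtP b s.+1) => [bs|bs|->].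
- rewrite -ltnS bs (leq_trans (leq_pred b)) -1?ltnS// subSn -1?ltnS//.
  case: b bs => [|b] bs.
    by rewrite mul0r addr0 subn0 exp_termS.
  have -> : (s - b.+1.-1 = (s - b.+1).+1)%N by lia.
  have -> : s.+1%:R = (s - b.+1).+1%:R + b.+1%:R :> R by rewrite -natrD; congr _%:R; lia.
  by rewrite mulrDl exp_termS.
- rewrite mulr0 leqNgt (leq_trans (leqnSn _) bs) /= mulr0 add0r.
  by rewrite (_ : (b.-1 <= s)%N = false) ?mulr0//; lia.
- by rewrite ltnn mulr0 add0r leqnn !subnn.
Qed.

Definition poisson_weight (a : {ffun 'I_m -> nat}) : R :=
  \prod_i (Hi i ^+ a i / (a i)`!%:R).

Lemma poisson_weightD i a :
  Hi i * poisson_weight a = (a i).+1%:R * poisson_weight (unit_vec i + a).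
Proof.
rewrite /poisson_weight (bigD1 i)//= [in RHS](bigD1 i)//= unit_vecD eqxx add1n.
rewrite [LHS]mulrA [RHS]mulrA exp_termS; congr (_ * _).
by apply: eq_bigr => i' ii'; rewrite unit_vecD (negbTE ii').
Qed.

Definition at_point (a v : {ffun 'I_m -> nat}) : R := (v == a)%:R.

(** The multinomial formula for (H_0 + H_1 + ... + H_m)^s, in which the exponents
    of the classes are prescribed by [a] and the lengths of no class fill up the
    other places. *)
Lemma marks_mass_point s a : marks_mass s (at_point a) =
  s`!%:R * (poisson_weight a * exp_term_shift H0 s (\sum_i a i)).
Proof.
elim: s a => [|s IHs] a.
  rewrite /marks_mass /= hornerC mul1r /at_point /exp_term_shift leqn0 sum_nat_eq0.
  case: eqVneq => [<-|a0].
    rewrite (introT forallP) => [|i]; last by rewrite ffunE.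
    rewrite sub0n fact0 divr1 expr0 mulr1 /poisson_weight big1// => i _.
    by rewrite ffunE expr0 divr1.
  case: forallP => [a0'|_]; last by rewrite mulr0.
  by case/negP: a0; apply/eqP/ffunP => i; rewrite ffunE; apply/esym/eqP/(a0' i).
rewrite marks_massS IHs.
have E i : Hi i * marks_mass s (fun v => at_point a (unit_vec i + v)) =
    s`!%:R * (poisson_weight a * ((a i)%:R * exp_term_shift H0 s (\sum_i a i).-1)).
  case ai: (a i) => [|c].
    rewrite mul0r !mulr0 (_ : (fun v => _) = fun=> 0); last first.
      apply/funext => v; rewrite /at_point; case: eqVneq => // va; move: ai.
      by rewrite -va unit_vecD eqxx.
    by rewrite /marks_mass marks_poly0 horner0 mulr0.
  pose b : {ffun 'I_m -> nat} := [ffun i' => (a i' - (i' == i))%N].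
  have ab : a = unit_vec i + b.
    apply/ffunP => i'; rewrite unit_vecD ffunE; case: eqVneq => [->|_]; rewrite ?subn0//.
    by rewrite ai subn1 add1n.
  rewrite (_ : (fun v => _) = at_point b); last first.
    apply/funext => v; rewrite /at_point ab; congr (nat_of_bool _)%:R.
    apply/eqP/eqP => [/ffunP H|->//]; apply/ffunP => i'.
    by have := H i'; rewrite !unit_vecD => /addnI.
  rewrite IHs mulrCA; congr (_ * _); rewrite [LHS]mulrA poisson_weightD -ab.
  have -> : (\sum_i a i).-1 = \sum_i b i.
    rewrite ab; under eq_bigr do rewrite unit_vecD.
    rewrite big_split /= (bigD1 i)//= eqxx big1 ?addn0// => i' ii'.
    by rewrite (negbTE ii').
  suff -> : b i = c by rewrite -mulrA mulrCA.
  by rewrite ffunE eqxx ai subn1.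
rewrite (eq_bigr _ (fun i _ => E i)).
rewrite -!mulr_sumr -mulr_suml -natr_sum.
rewrite mulrCA -mulrDr (mulrCA H0) -mulrDr -exp_term_shiftS factS natrM.
by rewrite -mulrA [in RHS]mulrCA; congr (_ * _); rewrite mulrCA.
Qed.

Lemma sum_marks_mass_point a M : \sum_(s < M) marks_mass s (at_point a) / s`!%:R =
  poisson_weight a * exp_sum H0 (M - \sum_i a i).
Proof.
under [LHS]eq_bigr => s _.
  rewrite marks_mass_point mulrC mulKf ?pnatr_eq0 -?lt0n ?fact_gt0//; over.
rewrite -mulr_sumr; congr (_ * _); set b := \sum_i a i.
rewrite -(big_mkord xpredT (fun s => exp_term_shift H0 s b)) /exp_sum.
have [Mb|bM] := leqP M b.
  rewrite (eqP (Mb : (M - b)%N == 0%N)) big_ord0 big_nat big1// => s /andP[_ sM].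
  by rewrite /exp_term_shift leqNgt (leq_trans sM Mb).
rewrite (big_cat_nat _ (n := b)) ?(ltnW bM)//= big_nat big1 ?add0r => [|s /andP[_ sb]]; last first.
  by rewrite /exp_term_shift leqNgt sb.
rewrite -[X in index_iota X]add0n big_addn big_mkord; apply: eq_bigr => s _.
by rewrite /exp_term_shift leq_addl addnK.
Qed.

Definition indic (L : seq {ffun 'I_m -> nat}) (v : {ffun 'I_m -> nat}) : R :=
  (v \in L)%:R.

Lemma sum_marks_mass_indic L M : uniq L ->
  \sum_(s < M) marks_mass s (indic L) / s`!%:R =
  \sum_(a <- L) poisson_weight a * exp_sum H0 (M - \sum_i a i).
Proof.
elim: L => [_|a L IHL /= /andP[aL uL]].
  rewrite big_nil big1// => s _.
  by rewrite (_ : indic [::] = fun=> 0) /marks_mass ?marks_poly0 ?horner0 ?mul0r//; apply/funext.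
rewrite big_cons -IHL// -sum_marks_mass_point -big_split; apply: eq_bigr => s _ /=.
rewrite -mulrDl /marks_mass -hornerD -marks_polyD; congr (_.[_] / _); congr marks_poly.
apply/funext => v; rewrite /indic /at_point inE -natrD; congr _%:R.
by case: eqVneq => [->|_] //=; rewrite (negbTE aL).
Qed.

Definition poisson_point (a : {ffun 'I_m -> nat}) : R :=
  \prod_i (Hi i ^+ a i / (a i)`!%:R * expR (- Hi i)).

Lemma poisson_pointE a : poisson_point a = expR (- harm k 1) * (poisson_weight a * expR H0).
Proof.
rewrite /poisson_point big_split /= -/(poisson_weight a) mulrCA; congr (_ * _).
rewrite -(big_morph expR (@expRD R) (expR0 R)) -expRD; congr expR.
by rewrite /H0 addKr sumrN.
Qed.

(** The error does not depend on [L]: this allows the passage to infinite sets. *)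
Lemma poisson_lower n (L : seq {ffun 'I_m -> nat}) (x : R) :
  (0 < k)%N -> (k <= n)%N -> x = n%:R / k%:R -> uniq L ->
  \sum_(a <- L) poisson_point a - perm_mean class_vec k n (indic L)
    <= 2 * expR (3 * x - x * ln x).
Proof.
move=> k0 kn xE uL; set eps := 2 * _.
have ind01 a : 0 <= indic L a <= 1 by rewrite /indic; case: (a \in L); rewrite ?lexx ?ler01.
have H1 : expR (- harm k 1) *
    (\sum_(a <- L) poisson_weight a * exp_sum H0 (M - \sum_i a i)) - perm_mean class_vec k n (indic L)
    @[M --> \oo] --> \sum_(a <- L) poisson_point a - perm_mean class_vec k n (indic L).
  apply: cvgB; last exact: cvg_cst.
  rewrite (eq_bigr _ (fun a _ => poisson_pointE a)) -mulr_sumr.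
  apply: cvgMl_tmp; elim: L {uL ind01 eps} => [|a L IHL].
    by rewrite big_nil; under eq_fun do rewrite big_nil; exact: cvg_cst.
  rewrite big_cons; under eq_fun do rewrite big_cons.
  apply: cvgD IHL; apply: cvgMl_tmp.
  by rewrite (cvg_centern (\sum_i a i) (exp_sum H0)); exact: cvg_exp_sum.
apply: (cvgr_to_le H1); near=> M.
rewrite -sum_marks_mass_indic//; exact: (perm_mean_lower_exp class_vec M k0 kn xE ind01).
Unshelve. all: by end_near.
Qed.

End vector.

(** * Passage to probabilities *)

Lemma poisson_prob_set1 (R : realType) (h : R) c : 0 <= h ->
  poisson_prob h 0%N [set c] = (h ^+ c / c`!%:R * expR (- h))%:E.
Proof.
rewrite le_eqVlt /poisson_prob => /orP[/eqP <-|h0].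
  rewrite ltxx oppr0 expR0 mulr1 diracE.
  case: c => [|c]; first by rewrite fact0 divr1 expr0 mem_set.
  by rewrite expr0n mul0r memNset.
by rewrite h0 esum_set1 ?lee_fin ?poisson_pmf_ge0// /poisson_pmf h0.
Qed.

Lemma harmonic_sum_ge0 (R : realType) (I : {fset nat}) : 0 <= harmonic_sum R I.
Proof. by apply: sumr_ge0 => j _; rewrite invr_ge0. Qed.

Section proba.
Variables (R : realType) (m : nat) (I : 'I_m -> {fset nat}).
Variables (d : measure_display) (T : measurableType d) (P : probability T R).
Variable (Y : 'I_m -> {RV P >-> nat}).
Hypothesis Ypois : forall i, has_poisson_law (Y i) (harmonic_sum R (I i)).
Hypothesis Yindep : mutually_independent Y.

Lemma measurable_coord i (B : set nat) : measurable [set w | B (Y i w)].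
Proof.
have -> : [set w | B (Y i w)] = Y i @^-1` B by [].
by rewrite -[X in measurable X]setTI; exact: measurable_funP.
Qed.

Lemma measurable_vec (B : 'I_m -> set nat) :
  measurable [set w | forall i, B i (Y i w)].
Proof.
have -> : [set w | forall i, B i (Y i w)] = \bigcap_(i in setT) [set w | B i (Y i w)].
  by apply/seteqP; split => w /= H i //; [move=> _; apply: H|exact: (H i Logic.I)].
apply: fin_bigcap_measurable => // i _; exact: measurable_coord.
Qed.

Lemma prob_vec_eq (a : {ffun 'I_m -> nat}) :
  P [set w | forall i, Y i w = a i] = (poisson_point R I a)%:E.
Proof.
have := Yindep [set: 'I_m]%SET (B := fun i => [set a i]) (fun _ => Logic.I).
have -> : [set w | forall i : 'I_m, i \in [set: 'I_m]%SET -> [set a i] (Y i w)] =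
   [set w | forall i, Y i w = a i].
  by apply/seteqP; split => w /= H i //; apply: H; rewrite inE.
move=> ->; rewrite /poisson_point -prodEFin.
apply: eq_big => [i|i _]; first by rewrite inE.
by rewrite -poisson_prob_set1 ?harmonic_sum_ge0// -Ypois.
Qed.

(** By subadditivity; the converse bound comes from complements at the end. *)
Lemma prob_vec_seq (L : seq {ffun 'I_m -> nat}) :
  (P [set w | [ffun i => Y i w] \in L] <= (\sum_(a <- L) poisson_point R I a)%:E)%E
  /\ measurable [set w | [ffun i => Y i w] \in L].
Proof.
elim: L => [|a L [IH1 IH2]].
  rewrite big_nil (_ : [set w | _] = set0); last by apply/seteqP; split.
  by rewrite measure0; split.
have -> : [set w | [ffun i => Y i w] \in a :: L] =
    [set w | forall i, Y i w = a i] `|` [set w | [ffun i => Y i w] \in L].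
  apply/seteqP; split => w /=; rewrite inE.
    by move=> /orP[/eqP <-|wL]; [left => i; rewrite ffunE|right].
  by case=> [H|->]; rewrite ?orbT//; apply/orP; left; apply/eqP/ffunP => i; rewrite ffunE.
have ma : measurable [set w | forall i, Y i w = a i].
  exact: (measurable_vec (fun i => [set a i])).
split; last exact: measurableU.
apply: le_trans (measureU2 _ _ _) _ => //.
by rewrite big_cons EFinD -prob_vec_eq; apply: leeD.
Qed.

Definition box_seq (J : set ('I_m -> nat)) b : seq {ffun 'I_m -> nat} :=
  [seq [ffun i => val (g i)] | g : {ffun 'I_m -> 'I_b} <-
     enum [pred g : {ffun 'I_m -> 'I_b} | `[< J (fun i => val (g i)) >]]].

Lemma box_seq_uniq J b : uniq (box_seq J b).
Proof.
rewrite map_inj_uniq ?enum_uniq// => g h /ffunP gh.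
by apply/ffunP => i; apply: val_inj; have := gh i; rewrite !ffunE.
Qed.

Lemma mem_box_seq (J : set ('I_m -> nat)) b (v : 'I_m -> nat) :
  [ffun i => v i] \in box_seq J b <-> J v /\ forall i, (v i < b)%N.
Proof.
split=> [/mapP[g]|[Jv vb]].
  rewrite mem_enum inE => Jg /ffunP vg.
  have vE i : v i = g i by have := vg i; rewrite !ffunE.
  split=> [|i]; last by rewrite vE.
  suff -> : v = (fun i => val (g i)) by [].
  by apply/funext => i; rewrite vE.
apply/mapP; exists [ffun i => Ordinal (vb i)].
  rewrite mem_enum inE (_ : (fun i => _) = v)//.
  by apply/funext => i; rewrite ffunE.
by apply/ffunP => i; rewrite !ffunE.
Qed.

(** Continuity from below along the boxes of side [b]. *)
Lemma prob_le_box (J : set ('I_m -> nat)) (c : R) :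
  (forall b, \sum_(a <- box_seq J b) poisson_point R I a <= c) ->
  (P [set w | J (fun i => Y i w)] <= c%:E)%E
  /\ measurable [set w | J (fun i => Y i w)].
Proof.
move=> Hc; pose G b := [set w | [ffun i => Y i w] \in box_seq J b].
have GE : \bigcup_b G b = [set w | J (fun i => Y i w)].
  apply/seteqP; split => w /=.
    by move=> [b _] /(mem_box_seq J b (fun i => Y i w))[].
  move=> Jw; exists (\max_i Y i w).+1 => //.
  apply/(mem_box_seq J _ (fun i => Y i w)); split=> // i.
  by rewrite ltnS; exact: (leq_bigmax i).
have Gm b : measurable (G b) by have [] := prob_vec_seq (box_seq J b).
have GUm : measurable (\bigcup_b G b) by exact: bigcup_measurable.
rewrite -GE; split=> //.
have Gnd : nondecreasing_seq G.
  move=> b c' bc; apply/subsetPset => w.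
  move=> /(mem_box_seq J b (fun i => Y i w))[Jw wb].
  apply/(mem_box_seq J c' (fun i => Y i w)); split=> // i.
  exact: leq_trans (wb i) bc.
apply: (cvge_to_le (nondecreasing_cvg_mu Gm GUm Gnd)).
exists 0%N => // b _ /=.
have [Pb _] := prob_vec_seq (box_seq J b).
by apply: le_trans Pb _; rewrite lee_fin.
Qed.

End proba.

Lemma uniform_perm_probE (R : realType) (n : nat) (E : set 'S_n) :
  uniform_perm_prob R E = (\sum_(s : 'S_n) `[< E s >]%:R) / n`!%:R.
Proof.
rewrite /uniform_perm_prob; congr (_ / _%:R); last first.
  by rewrite cardsT card_Sn.
rewrite -sum1_card natr_sum [RHS](bigID (fun s => `[< E s >])) /=.
rewrite [X in _ = _ + X]big1 ?addr0 => [|s /negbTE -> //].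
by apply: eq_big => s; rewrite inE// => ->.
Qed.

Lemma cycle_stat_count n m (I : 'I_m -> {fset nat}) (s : 'S_n) :
  cycle_stat (class_vec I) [set: 'I_n] s = [ffun i => cycle_count (I i) s].
Proof.
apply/ffunP => i; rewrite /cycle_stat sum_ffunE ffunE /cycle_count.
rewrite -sum1_card; under [LHS]eq_bigr do rewrite ffunE.
rewrite big_mkcond [RHS]big_mkcond /=; apply: eq_bigr => c _.
rewrite inE finset.subsetT andbT; case: (c \in porbits s) => //=.
Qed.

Lemma perm_mean_indic (R : realType) n k m (I : 'I_m -> {fset nat}) (L : seq {ffun 'I_m -> nat}) :
  (forall i j, j \in I i -> (1 <= j <= k)%N) ->
  perm_mean (class_vec I) k n (indic R L) =
  (\sum_(s : 'S_n) ([ffun i => cycle_count (I i) s] \in L)%:R) / n`!%:R.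
Proof.
move=> Ik.
have mS n' (phi : _ -> R) := perm_meanS n' phi (class_vec_large Ik).
have H := @sum_cycle_stat R _ (class_vec I) (perm_mean (class_vec I) k) (perm_mean0 _ k) mS _
   [set: 'I_n]%SET (indic R L).
rewrite cardsT card_ord in H.
rewrite -(mulKf (_ : n`!%:R != 0) (perm_mean _ _ _ _)) ?pnatr_eq0 -?lt0n ?fact_gt0//.
rewrite -H mulrC; congr (_ * _); apply: eq_big => s.
  by apply/fintype.subsetP => j _; rewrite inE.
by rewrite cycle_stat_count.
Qed.

(** The finite case in probabilistic terms, extended to all [J] by
    [prob_le_box]. *)
Lemma poisson_le_perm (R : realType) n k m (I : 'I_m -> {fset nat}) (J : set ('I_m -> nat)) (x : R) :
  (1 <= k <= n)%N ->
  (forall i j, j \in I i -> (1 <= j <= k)%N) ->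
  (forall i i', i != i' -> [disjoint I i & I i']%fset) ->
  forall (d : measure_display) (T : measurableType d)
    (P : probability T R) (Y : 'I_m -> {RV P >-> nat}),
  (forall i, has_poisson_law (Y i) (harmonic_sum R (I i))) ->
  mutually_independent Y -> x = n%:R / k%:R ->
  fine (P [set w | J (fun i => Y i w)])
   <= uniform_perm_prob R [set s : 'S_n | J (fun i => cycle_count (I i) s)]
     + 2 * expR (3 * x - x * ln x) /\ measurable [set w | J (fun i => Y i w)].
Proof.
move=> /andP[k0 kn] Ik Id d T P Y Yp Yi xE.
set U := uniform_perm_prob _ _; set eps := 2 * _.
have [b|PJ mJ] := prob_le_box Yp Yi (J := J) (c := U + eps).
  rewrite -lerBlDl; apply: le_trans (poisson_lower Ik Id k0 kn xE (box_seq_uniq J b)).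
  rewrite lerD2l lerN2 perm_mean_indic// /U uniform_perm_probE ler_wpM2r ?invr_ge0//.
  apply: ler_sum => s _; rewrite ler_nat.
  case: (boolP (_ \in _)) => // /(mem_box_seq J b (fun i => cycle_count (I i) s))[Js _].
  by rewrite asboolT.
split=> //; rewrite -lee_fin fineK//; exact: fin_num_measure.
Qed.

(** * Total variation and the choice of f *)

Lemma uniform_perm_probC (R : realType) n (E : set 'S_n) :
  uniform_perm_prob R (~` E) = 1 - uniform_perm_prob R E.
Proof.
apply/eqP; rewrite -subr_eq opprK !uniform_perm_probE -mulrDl -big_split /=.
have -> : \sum_(s : 'S_n) (`[< (~` E) s >]%:R + `[< E s >]%:R) = n`!%:R :> R.
  rewrite (eq_bigr (fun=> 1)) => [|s _]; last first.
    by case: (pselect (E s)) => Es;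
      [rewrite (asboolT Es) asboolF ?add0r | rewrite (asboolF Es) asboolT ?addr0].
  by rewrite sumr_const cardT -cardE card_Sn.
by rewrite divff// pnatr_eq0 -lt0n fact_gt0.
Qed.

Lemma uniform_perm_prob01 (R : realType) n (E : set 'S_n) :
  0 <= uniform_perm_prob R E <= 1.
Proof.
have H (F : set 'S_n) : 0 <= uniform_perm_prob R F by rewrite mulr_ge0 ?invr_ge0.
by rewrite H -subr_ge0 -uniform_perm_probC H.
Qed.

(** The one-sided bound for [J] and for its complement. *)
Lemma perm_poisson_dist (R : realType) n k m (I : 'I_m -> {fset nat})
    (J : set ('I_m -> nat)) (x : R) :
  (1 <= k <= n)%N ->
  (forall i j, j \in I i -> (1 <= j <= k)%N) ->
  (forall i i', i != i' -> [disjoint I i & I i']%fset) ->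
  forall (d : measure_display) (T : measurableType d)
    (P : probability T R) (Y : 'I_m -> {RV P >-> nat}),
  (forall i, has_poisson_law (Y i) (harmonic_sum R (I i))) ->
  mutually_independent Y -> x = n%:R / k%:R ->
  let D := `|uniform_perm_prob R [set s : 'S_n | J (fun i => cycle_count (I i) s)]
     - fine (P [set w | J (fun i => Y i w)])| in
  D <= 1 /\ D <= 2 * expR (3 * x - x * ln x).
Proof.
move=> kn Ik Id d T P Y Yp Yi xE D; rewrite /D.
have [J1 mJ] := poisson_le_perm J kn Ik Id Yp Yi xE.
have [J2 _] := poisson_le_perm (~` J) kn Ik Id Yp Yi xE.
have UC := uniform_perm_probC R [set s : 'S_n | J (fun i => cycle_count (I i) s)].
have PC := probability_setC P mJ.
have U01 := uniform_perm_prob01 R [set s : 'S_n | J (fun i => cycle_count (I i) s)].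
have PE : P [set w | J (fun i => Y i w)] = (fine (P [set w | J (fun i => Y i w)]))%:E.
  by rewrite fineK//; exact: fin_num_measure.
move: J2; rewrite -[[set w | (~` J) _]]/(~` [set w | J (fun i => Y i w)]) PC PE.
rewrite -[[set s | (~` J) _]]/(~` [set s : 'S_n | J (fun i => cycle_count (I i) s)]) UC.
have := fine_ge0 (measure_ge0 P [set w | J (fun i => Y i w)]); have := probability_le1 P mJ.
rewrite PE !lee_fin; move: J1 U01 => /=.
set u := uniform_perm_prob _ _; set p := fine _; set eps := 2 * _.
move=> J1 /andP[u0 u1] p1 p0 J2.
by split; rewrite ler_norml; apply/andP; split; lra.
Qed.

(** Follows from e^(1/2) <= 2, which is the inverse of 1 - 1/2 <= e^(-1/2). *)
Lemma lnlnln_ge (R : realType) (x : R) : 20 <= x -> -1 <= ln (ln (ln x)).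
Proof.
move=> x20.
have e2 : expR (2^-1) <= 2 :> R.
  rewrite -[leRHS]invrK -[2^-1 in leLHS]opprK expRN lef_pV2 ?posrE ?expR_gt0//.
  by apply: le_trans (expR_ge1Dx _); lra.
have e16 : expR 2 <= 16 :> R.
  have -> : 2 = 4%:R * 2^-1 :> R by lra.
  rewrite expRM_natl; apply: (@le_trans _ _ (2 ^+ 4)); last by lra.
  by rewrite lerXn2r ?nnegrE ?expR_ge0.
have H1 : 2 <= ln x by rewrite -ler_expR lnK ?posrE; lra.
have H2 : 2^-1 <= ln (ln x).
  by rewrite -ler_expR lnK ?posrE; [exact: le_trans H1 | lra].
rewrite -ler_expR lnK ?posrE; last by lra.
apply: le_trans H2; rewrite expRN lef_pV2 ?posrE ?expR_gt0//.
by apply: le_trans (expR_ge1Dx _); lra.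
Qed.

Theorem theorem1p20 (R : realType) :
  exists f : R -> R,
    [/\ forall x : R, 1 <= x -> x <= 20 -> f x = 0,
        exists C : R, forall x : R, 20 <= x ->
          `|f x - (x * ln x - x * ln (ln (ln x)))| <= C * x
      & exists C : R,
          forall (n k m : nat) (I : 'I_m -> {fset nat}) (J : set ('I_m -> nat)),
          (1 <= k <= n)%N ->
          (forall i j, j \in I i -> (1 <= j <= k)%N) ->
          (forall i i', i != i' -> [disjoint I i & I i']%fset) ->
          forall (d : measure_display) (T : measurableType d)
            (P : probability T R) (Y : 'I_m -> {RV P >-> nat}),
          (forall i, has_poisson_law (Y i) (harmonic_sum R (I i))) ->
          mutually_independent Y ->
          `|uniform_perm_prob R [set s : 'S_n | J (fun i => cycle_count (I i) s)]
            - fine (P [set w | J (fun i => Y i w)])|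
          <= C * expR (- f (n%:R / k%:R)) ].
Proof.
pose g (x : R) := x * ln x - x * ln (ln (ln x)).
exists (fun x => if x <= 20 then 0 else g x - 4 * x); split.
- by move=> x _ ->.
- (* The second summand accounts for the single point x = 20, where f vanishes. *)
  exists (4 + `|g 20|) => x x20; have g0 := normr_ge0 (g 20).
  rewrite -/(g x); case: ifPn => [x20'|_]; last first.
    by rewrite addrAC subrr add0r normrN ger0_norm; nra.
  have -> : x = 20 by apply/eqP; rewrite eq_le x20'.
  by rewrite sub0r normrN; nra.
exists 2 => n k m I J kn Ik Id d T P Y Yp Yi.
have [D1 D2] := perm_poisson_dist J kn Ik Id Yp Yi erefl.
case: ifPn => [_|]; first by rewrite oppr0 expR0 mulr1; apply: le_trans D1 _; rewrite ler1n.
move: D2; set x : R := n%:R / k%:R => D2; rewrite -ltNge => x20.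
apply: le_trans D2 _; rewrite ler_wpM2l// ler_expR /g.
have := lnlnln_ge (ltW x20); move: (x * ln x) (ln (ln (ln x))) => a b b1.
by nra.
Qed.
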